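(* Let $m=3$. There is a nonzero constant $c$ (depending only on the dual torus $\widetilde T$ and orientation conventions) with the following property. Let $C=\{y^j=\sum_k\phi^{jk}\,\partial f/\partial x^k\}\subset M$ be a special Lagrangian section of the semi-flat torus fibration $\pi: M\to B$, where $f$ is a smooth real function on $B$. Let $d+A$, $A=i\sum_k e_k(x)\,dx^k$, with $e_k$ Hermitian $r\times r$ matrix valued functions, be an arbitrary (not necessarily flat) unitary connection of rank $r\geq 1$ on $C$. Let $\mathcal A_0$ and $\mathcal A$ be the connections on the trivial rank $r$ bundle over $W$ given by $$\mathcal A_0=d+i\sum_{j,k}\phi^{jk}\frac{\partial f}{\partial x^k}\,d\widetilde y_j\cdot\mathrm{Id}_r,\qquad \mathcal A=d+i\sum_{j,k}\Big(\phi^{jk}\frac{\partial f}{\partial x^k}\,d\widetilde y_j\cdot\mathrm{Id}_r+e_k\phi^{jk}\,d\widetilde x_j\Big),$$ i.e. the real Fourier-Mukai transforms of $C$ alone and of $(C,d+A)$ respectively. Assume $A$ satisfies boundary or growth conditions such that the integrals below converge absolutely. Then $$CS_{hol}(\mathcal A,\mathcal A_0)=c\cdot CS(A),$$ where $$CS(A)=\int_C \operatorname{Tr}\Big(A\wedge dA+\tfrac23A\wedge A\wedge A\Big),$$ $$CS_{hol}(\mathcal A,\mathcal A_0)=\int_W\widetilde\Omega\wedge\operatorname{Tr}\Big(\mathcal B\wedge\bar\partial_{\mathcal A_0}\mathcal B+\tfrac23\,\mathcal B\wedge\mathcal B\wedge\mathcal B\Big),\qquad \mathcal B=(\mathcal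 A-\mathcal A_0)^{0,1}.$$
   Context: Semi-flat setting (with $m=3$). $B\subset\mathbb R^m$ is an open ball with coordinates $x^1,\dots,x^m$, and $\phi:B\to\mathbb R$ is a smooth function with positive definite Hessian $\phi_{ij}=\partial^2\phi/\partial x^i\partial x^j$ satisfying the real Monge-Ampère equation $\det(\phi_{ij})=\mathrm{const}$; $(\phi^{ij})$ is the inverse matrix of $(\phi_{ij})$. $M=B\times T$, where $T=\mathbb R^m/\Lambda$ is a torus ($\Lambda$ a lattice) with coordinates $y^1,\dots,y^m$, and $\pi:M\to B$ is the projection. $M$ has complex coordinates $z^j=x^j+iy^j$, Kähler form $\omega=\frac i2\sum\phi_{ij}\,dz^i\wedge d\bar z^j$, and holomorphic volume form $\Omega=dz^1\wedge\dots\wedge dz^m$. A section $C$ is special Lagrangian if $\omega|_C=0$ and $\operatorname{Im}\Omega|_C=\tan\theta\operatorname{Re}\Omega|_C$ for some constant $\theta$. The section $C$ is identified with $B$ via $\pi$. The dual torus is $\widetilde T=\mathbb R^m/\Lambda^*$ with coordinates $\widetilde y_1,\dots,\widetilde y_m$, where $\Lambda^*=\{\widetilde y:\sum_j y^j\widetilde y_j\in2\pi\mathbb Z\ \text{for all } y\in\Lambda\}$. The mirror is $W=B\times\widetilde T$. Put $\widetilde x_j=\partial\phi/\partial x^j$, so $d\widetilde x_j=\sum_k\phi_{jk}dx^k$; these are coordinates on $B$. $W$ has complex coordinates $\widetilde z_j=\widetilde x_j+i\widetilde y_j$ and holomorphic volume form $\widetilde\Omega=d\widetilde z_1\wedge\dots\wedge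 d\widetilde z_m$. $\bar\partial_{\mathcal A_0}$ denotes the $(0,1)$-part of the covariant exterior derivative of $\mathcal A_0$ acting on $\mathrm{End}$-valued forms; since $C$ is Lagrangian, $\mathcal A_0$ has curvature of vanishing $(0,2)$-part, so $\bar\partial_{\mathcal A_0}$ defines the background holomorphic structure. Functions and forms on $B$ are regarded as functions and forms on $W$ by pull-back. *)

(* Defs.v *)
From HB Require Import structures.
From mathcomp Require Import all_boot all_order all_algebra.
From mathcomp Require Import complex.
From mathcomp Require Import all_classical all_reals all_analysis.

Set Implicit Arguments.
Unset Strict Implicit.
Unset Printing Implicit Defensive.

Import Order.TTheory GRing.Theory Num.Theory.
Import numFieldNormedType.Exports.

Local Open Scope classical_set_scope.
Local Open Scope ring_scope.
Local Open Scope complex_scope.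

Definition partial (R : realType) n (i : 'I_n) (g : 'rV[R]_n -> R)
  (x : 'rV[R]_n) : R := 'D_(delta_mx 0 i) g x.

(* C^infinity: every iterated partial derivative is differentiable on U. *)
Definition smooth_on (R : realType) n (U : set 'rV[R]_n) (g : 'rV[R]_n -> R) :=
  forall (s : seq 'I_n) (x : 'rV[R]_n),
    U x -> differentiable (foldr (@partial R n) g s) x.

Definition smooth_mx_on (R : realType) n r (U : set 'rV[R]_n)
  (g : 'rV[R]_n -> 'M[R[i]]_r) :=
  forall a b, smooth_on U (fun x => complex.Re (g x a b)) /\
              smooth_on U (fun x => complex.Im (g x a b)).

(* Complex- and matrix-valued functions are differentiated componentwise. *)
Definition cpartial (R : realType) n (i : 'I_n) (g : 'rV[R]_n -> R[i])
  (x : 'rV[R]_n) : R[i] :=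
  partial i (fun y => complex.Re (g y)) x
    +i* partial i (fun y => complex.Im (g y)) x.

Definition mxpartial (R : realType) n r (i : 'I_n) (g : 'rV[R]_n -> 'M[R[i]]_r)
  (x : 'rV[R]_n) : 'M[R[i]]_r :=
  \matrix_(a, b) cpartial i (fun y => g y a b) x.

(* [w x I] is the coefficient at x of dx_{i_1} /\ ... /\ dx_{i_k}, where      *)
(* I = {i_1 < ... < i_k}. Forms may be of mixed degree, and only their values *)
(* on the open set under consideration matter.                                *)
Definition form (R : realType) n (V : Type) : Type :=
  'rV[R]_n -> {ffun {set 'I_n} -> V}.

(* Sign of the permutation sorting the concatenation of I and J. *)
Definition shuffle_sign (V : pzRingType) n (I J : {set 'I_n}) : V :=
  (-1) ^+ #|[set p : 'I_n * 'I_n |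
              [&& p.1 \in I, p.2 \in J & (p.2 < p.1)%N]]%SET|.

Section Forms.
Context {R : realType} {n : nat}.
Local Notation C := R[i].
Local Notation form V := (form R n V).

Definition wedge (V : pzRingType) (a b : form V) : form V := fun x =>
  [ffun K : {set 'I_n} => \sum_(I : {set 'I_n} | I \subset K)
     shuffle_sign V I (K :\: I) * (a x I * b x (K :\: I))].

Definition dcoord (V : pzRingType) (i : 'I_n) : form V := fun=>
  [ffun I : {set 'I_n} => (I == [set i]%SET)%:R].

Definition form0 (g : 'rV[R]_n -> C) : form C := fun x =>
  [ffun I : {set 'I_n} => if I == finset.set0 then g x else 0].

Definition wedges (s : seq (form C)) : form C :=
  foldr (@wedge C) (form0 (fun=> 1)) s.

(* d w = \sum_i dx_i /\ (D_i w), where D is the componentwise partial         *)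
(* derivative on V-valued functions.                                          *)
Definition extd_with (V : pzRingType)
  (D : 'I_n -> ('rV[R]_n -> V) -> 'rV[R]_n -> V) (w : form V) : form V :=
  \sum_(i < n) wedge (dcoord V i)
                     (fun x => [ffun I => D i (fun y => w y I) x]).

Definition extd : form C -> form C := extd_with (@cpartial R n).

Definition mxextd r : form 'M[C]_r -> form 'M[C]_r :=
  extd_with (@mxpartial R n r).

Definition dfun (g : 'rV[R]_n -> C) : form C := extd (form0 g).

Definition fscale (g : 'rV[R]_n -> C) (w : form C) : form C :=
  fun x => g x *: w x.

Definition form_conj (w : form C) : form C := fun x =>
  [ffun I => (w x I)^*].

(* The matrix-valued form w . g *)
Definition form_mx r (w : form C) (g : 'rV[R]_n -> 'M[C]_r) : form 'M[C]_r :=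
  fun x => [ffun I => w x I *: g x].

Definition form_tr r (w : form 'M[C]_r) : form C := fun x =>
  [ffun I => \tr (w x I)].

(* The covariant exterior derivative of d + a on End-valued forms:            *)
(* on k-forms, w |-> dw + a /\ w - (-1)^k w /\ a.                             *)
Definition covd r (a w : form 'M[C]_r) : form 'M[C]_r :=
  mxextd w + wedge a w
  - wedge (fun x => [ffun I : {set 'I_n} => (-1) ^+ #|I| * w x I]) a.

End Forms.

(* F^*(g dx_{i_1} /\ ... /\ dx_{i_k}) = (g o F) dF_{i_1} /\ ... /\ dF_{i_k} *)
Definition pullback (R : realType) n p (F : 'rV[R]_n -> 'rV[R]_p)
  (w : form R p R[i]) : form R n R[i] := fun x =>
  \sum_(I : {set 'I_p})
    w (F x) I *: wedges [seq dfun (fun y => (F y 0 i)%:C) | i <- enum I] x.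

Section ComplexCoordinates.
Context {R : realType} {m : nat} (z : 'I_m -> 'rV[R]_(m + m) -> R[i]).
Local Notation C := R[i].

(* Row j (resp. m + j) holds the coefficients of dz_j (resp. its conjugate)   *)
(* in the frame dx_i; row i of the inverse expands dx_i in the dz_j and their *)
(* conjugates.                                                                *)
Definition coframe (x : 'rV[R]_(m + m)) : 'M[C]_(m + m) :=
  let Z := \matrix_(j < m, i < m + m) cpartial i (z j) x in
  col_mx Z (map_mx (@conjc R) Z).

Definition dcoord10 (i : 'I_(m + m)) : form R (m + m) C := fun x =>
  \sum_(j < m) invmx (coframe x) i (lshift m j) *: dfun (z j) x.

Definition dcoord01 (i : 'I_(m + m)) : form R (m + m) C := fun x =>
  \sum_(j < m) invmx (coframe x) i (rshift m j) *: form_conj (dfun (z j)) x.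

(* Expand each dx_i as dcoord10 i + dcoord01 i in                             *)
(* dx_{i_1} /\ ... /\ dx_{i_k}, keeping the terms in which the set S of       *)
(* indices where the (1,0)-part is selected has p elements and the set where  *)
(* the (0,1)-part is selected has q elements.                                 *)
Definition pqpart r (p q : nat) (w : form R (m + m) 'M[C]_r)
  : form R (m + m) 'M[C]_r := fun x =>
  [ffun K => \sum_(I : {set 'I_(m + m)})
     \sum_(S : {set 'I_(m + m)} |
           [&& S \subset I, #|S| == p & #|I :\: S| == q])
       wedges [seq if i \in S then dcoord10 i else dcoord01 i | i <- enum I] x K
         *: w x I].

(* dbar_a on forms of type (p, q), for the connection d + a *)
Definition dbar r (p q : nat) (a w : form R (m + m) 'M[C]_r) :=
  pqpart p q.+1 (covd a w).

Definition volform : form R (m + m) C :=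
  wedges [seq dfun (z j) | j <- enum 'I_m].

End ComplexCoordinates.

Section Lattices.
Context {R : realType} {m : nat}.

Definition lattice_basis (L : 'M[R]_m) (Lambda : set 'rV[R]_m) :=
  L \in unitmx /\
  Lambda = [set y | exists k : 'rV[int]_m, y = map_mx intr k *m L].

Definition is_lattice (Lambda : set 'rV[R]_m) :=
  exists L, lattice_basis L Lambda.

Definition dual_lattice (Lambda : set 'rV[R]_m) : set 'rV[R]_m :=
  [set yt | forall y, Lambda y ->
     exists k : int, \sum_(j < m) y 0 j * yt 0 j = k%:~R * (2 * pi)].

(* Fundamental domain of the lattice with basis the rows of L *)
Definition cell (L : 'M[R]_m) : set 'rV[R]_m :=
  [set y | exists2 t : 'rV[R]_m, (forall j, 0 <= t 0 j < 1) & y = t *m L].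

End Lattices.

(* Points of B x T and B x T~ are lifted to row_mx x y and row_mx x yt in     *)
(* R^(m + m); forms on M and W are written on their covers B x R^m.           *)
Section SemiFlat.
Context {R : realType} {m : nat}.
Local Notation C := R[i].
Implicit Types (B : set 'rV[R]_m) (phi f : 'rV[R]_m -> R).

Definition open_ball (a : 'rV[R]_m) (rho : R) : set 'rV[R]_m :=
  [set x | \sum_(j < m) (x 0 j - a 0 j) ^+ 2 < rho ^+ 2].

Definition hess phi (x : 'rV[R]_m) : 'M[R]_m :=
  \matrix_(i, j) partial i (partial j phi) x.

Definition posdef (H : 'M[R]_m) :=
  forall v : 'rV[R]_m, v != 0 -> 0 < (v *m H *m v^T) 0 0.

Definition monge_ampere_potential B phi :=
  [/\ smooth_on B phi, (forall x, B x -> posdef (hess phi x)) &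
      exists k : R, forall x, B x -> \det (hess phi x) = k].

(* phi^{jk} *)
Definition ihess phi (x : 'rV[R]_m) : 'M[R]_m := invmx (hess phi x).

(* Coordinates z^j = x^j + i y^j on M *)
Definition zM (j : 'I_m) (p : 'rV[R]_(m + m)) : C :=
  lsubmx p 0 j +i* rsubmx p 0 j.

Definition OmegaM : form R (m + m) C := volform zM.

Definition omegaM phi : form R (m + m) C :=
  ('i / 2) *: \sum_(j < m) \sum_(k < m)
    fscale (fun p => (hess phi (lsubmx p) j k)%:C)
      (wedge (dfun (zM j)) (form_conj (dfun (zM k)))).

Definition graphC phi f (x : 'rV[R]_m) : 'rV[R]_(m + m) :=
  row_mx x (\row_j \sum_(k < m) ihess phi x j k * partial k f x).

(* The condition cos theta <> 0 is needed because [tan theta] is 0 there. *)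
Definition special_lagrangian B phi (s : 'rV[R]_m -> 'rV[R]_(m + m)) :=
  (forall x, B x -> forall I, pullback s (omegaM phi) x I = 0) /\
  exists2 theta : R, cos theta != 0 &
    forall x, B x -> forall I, complex.Im (pullback s OmegaM x I) =
                               tan theta * complex.Re (pullback s OmegaM x I).

(* x~_j = d phi / d x^j, as a function on W, and z~_j = x~_j + i y~_j *)
Definition xW phi (j : 'I_m) (p : 'rV[R]_(m + m)) : R :=
  partial j phi (lsubmx p).

Definition zW phi (j : 'I_m) (p : 'rV[R]_(m + m)) : C :=
  xW phi j p +i* rsubmx p 0 j.

Definition OmegaW phi : form R (m + m) C := volform (zW phi).

Definition dxW phi (j : 'I_m) : form R (m + m) C :=
  dfun (fun p => (xW phi j p)%:C).

Definition dyW (j : 'I_m) : form R (m + m) C :=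
  dfun (fun p => (rsubmx p 0 j)%:C).

Section Connections.
Context {r : nat}.
Implicit Type e : 'I_m -> 'rV[R]_m -> 'M[C]_r.

(* The connection form A = i \sum_k e_k dx^k on C, identified with B *)
Definition connC e : form R m 'M[C]_r :=
  'i *: \sum_(k < m) form_mx (dcoord C k) (e k).

(* The connection forms of A_0 and A on W *)
Definition connW0 phi f : form R (m + m) 'M[C]_r :=
  'i *: \sum_(j < m) \sum_(k < m)
    form_mx (dyW j)
      (fun p => (ihess phi (lsubmx p) j k * partial k f (lsubmx p))%:C%:M).

Definition connW phi f e : form R (m + m) 'M[C]_r :=
  'i *: \sum_(j < m) \sum_(k < m)
    (form_mx (dyW j)
       (fun p => (ihess phi (lsubmx p) j k * partial k f (lsubmx p))%:C%:M) +
     form_mx (dxW phi j)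
       (fun p => (ihess phi (lsubmx p) j k)%:C *: e k (lsubmx p))).

Definition CS_form (A : form R m 'M[C]_r) : form R m C :=
  form_tr (wedge A (mxextd A) + (2 / 3 : C) *: wedge A (wedge A A)).

Definition CShol_form phi (A A0 : form R (m + m) 'M[C]_r) : form R (m + m) C :=
  let b := pqpart (zW phi) 0 1 (A - A0) in
  wedge (OmegaW phi)
    (form_tr (wedge b (dbar (zW phi) 0 1 A0 b)
              + (2 / 3 : C) *: wedge b (wedge b b))).

End Connections.
End SemiFlat.

Section ComplexIntegral.
Context d (T : measurableType d) (R : realType).
Variables (mu : {measure set T -> \bar R}) (D : set T) (g : T -> R[i]).

Definition cintegrable :=
  mu.-integrable D (fun t => (complex.Re (g t))%:E) /\
  mu.-integrable D (fun t => (complex.Im (g t))%:E).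

Definition cintegral : R[i] :=
  Rintegral mu D (fun t => complex.Re (g t))
    +i* Rintegral mu D (fun t => complex.Im (g t)).

End ComplexIntegral.

(* The product measure m1 \x m2 under its own name: on [_ \x _] itself the    *)
(* sigma-finite structure is not inferred, being shadowed by the one for      *)
(* subprobabilities.                                                          *)
Section ProductMeasure.
Context d1 d2 (T1 : measurableType d1) (T2 : measurableType d2) (R : realType).
Variable m1 : {sigma_finite_measure set T1 -> \bar R}.
Variable m2 : {sigma_finite_measure set T2 -> \bar R}.

Definition prod_measure : set (T1 * T2)%type -> \bar R := (m1 \x m2)%E.
HB.instance Definition _ := Measure.on prod_measure.

Lemma prod_measure_sigma_finite : sigma_finite setT prod_measure.
Proof.
have /sigma_finiteP[F [TF ndF Foo]] := sigma_finiteT m1.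
have /sigma_finiteP[G [TG ndG Goo]] := sigma_finiteT m2.
exists (fun n => F n `*` G n).
  rewrite -setXTT TF TG predeqE => -[x y]; split.
    move=> [/= [n _ Fnx] [k _ Gky]]; exists (maxn n k) => //; split.
    - by move: x Fnx; exact/subsetPset/ndF/leq_maxl.
    - by move: y Gky; exact/subsetPset/ndG/leq_maxr.
  by move=> [n _ []/= ? ?]; split; exists n.
move=> k; have [? ?] := Foo k; have [? ?] := Goo k.
split; first exact: measurableX.
by rewrite /prod_measure product_measure1E// lte_mul_pinfty// ge0_fin_numE.
Qed.

HB.instance Definition _ := @Measure_isSigmaFinite.Build _ _ _ prod_measure
  prod_measure_sigma_finite.

End ProductMeasure.

Section Integrals.
Context {R : realType}.
Local Notation leb := (@lebesgue_measure R).
Local Notation mR := (measurableTypeR R).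
Local Notation R3 := (mR * (mR * mR))%type.

Definition leb3 : {sigma_finite_measure set R3 -> \bar R} :=
  prod_measure leb (prod_measure leb leb).

Definition leb6 : {sigma_finite_measure set (R3 * R3)%type -> \bar R} :=
  prod_measure leb3 leb3.

Definition vec3 (t : R3) : 'rV[R]_3 := \row_(i < 3) [:: t.1; t.2.1; t.2.2]`_i.

Definition top_coef n (w : form R n R[i]) (x : 'rV[R]_n) : R[i] :=
  w x finset.setT.

(* C, identified with B, is oriented by dx^1 /\ dx^2 /\ dx^3. *)
Definition formC_integrable (B : set 'rV[R]_3) (w : form R 3 R[i]) :=
  cintegrable leb3 [set t | B (vec3 t)] (fun t => top_coef w (vec3 t)).

Definition formC_integral (B : set 'rV[R]_3) (w : form R 3 R[i]) :=
  cintegral leb3 [set t | B (vec3 t)] (fun t => top_coef w (vec3 t)).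

(* W = B x R^3 / Lambda^* is oriented by dx^1 dx^2 dx^3 dy~_1 dy~_2 dy~_3;    *)
(* the rows of Lt are a basis of Lambda^*, and a form on W is integrated over *)
(* the corresponding fundamental domain.                                      *)
Definition domW (B : set 'rV[R]_3) (Lt : 'M[R]_3) : set (R3 * R3)%type :=
  [set p | B (vec3 p.1) /\ cell Lt (vec3 p.2)].

Definition formW_integrable (B : set 'rV[R]_3) (Lt : 'M[R]_3)
  (w : form R (3 + 3) R[i]) :=
  cintegrable leb6 (domW B Lt)
    (fun p => top_coef w (row_mx (vec3 p.1) (vec3 p.2))).

Definition formW_integral (B : set 'rV[R]_3) (Lt : 'M[R]_3)
  (w : form R (3 + 3) R[i]) :=
  cintegral leb6 (domW B Lt)
    (fun p => top_coef w (row_mx (vec3 p.1) (vec3 p.2))).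

End Integrals.

(* Main.v *)
Require Import Defs.
From HB Require Import structures.
From mathcomp Require Import all_boot all_order all_algebra.
From mathcomp Require Import complex.
From mathcomp Require Import all_classical all_reals all_analysis.
From mathcomp Require Import measurable_realfun ring lra.

(** The identity holds pointwise on [B], before integration.

    Write [theta^k] for the (0,1)-part of [dx^k] on [W].  Since
    [dx~_j = \sum_k phi_{jk} dx^k], the difference of the two connections is
    [A - A_0 = i \sum_k e_k dx^k], so its (0,1)-part is
    [b = i \sum_k e_k theta^k] ([dbarpartE]).  The form [A_0] is a scalar
    1-form, hence drops out of the covariant derivative of [b].  What is left
    of [dbar b] is [i \sum_{l,k} d_l e_k theta^l theta^k], because the
    (0,2)-part of [d theta^k] is, up to a factor, the contraction of
    [theta^l theta^p] with [\sum_j phi^{kj} d_l phi_{jp}], which is symmetric in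
    [l] and [p] by the symmetry of third derivatives ([schwarz],
    [frame_contraction], [dbar_dbarpart]).

    So the Chern-Simons expression of [b] is obtained from that of
    [i \sum_k e_k dx^k] by replacing [dx^k] with [theta^k], and both are the
    same matrix [cs_density] times a product of three anticommuting 1-forms
    ([cs_core]).  Finally [Omega~ theta^1 theta^2 theta^3] is [i] times the
    oriented coordinate volume form of [W]: the Jacobian of the holomorphic
    frame and that of the antiholomorphic one are inverse to each other
    ([holomorphic_antiholomorphic_top]).  The two integrands thus differ by the
    factor [i] ([CShol_top]), and Fubini gives [c = i vol(T~)].

    The volume of the torus must not depend on the lattice basis defining the
    cell: two fundamental domains of the same lattice have the same measure
    ([fundamental_domain_measure], [cell3_measure]). *)

Set Implicit Arguments.
Unset Strict Implicit.
Unset Printing Implicit Defensive.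

Import Order.TTheory GRing.Theory Num.Theory.
Import numFieldNormedType.Exports.

Local Open Scope ring_scope.

(** * Exterior algebras *)

(* The local imports give finite sets precedence over classical sets. *)
Section ShuffleSign.
Import fintype boot.finset.
Variables (V : pzRingType) (n : nat).
Implicit Types I J K : {set 'I_n}.

Lemma shuffle_sign0l J : shuffle_sign V set0 J = 1.
Proof. by rewrite /shuffle_sign eq_card0 // => p; rewrite !inE. Qed.

Lemma shuffle_sign0r I : shuffle_sign V I set0 = 1.
Proof. by rewrite /shuffle_sign eq_card0 // => p; rewrite !inE andbF. Qed.

Lemma shuffle_signUl I J K : [disjoint I & J] ->
  shuffle_sign V (I :|: J) K = shuffle_sign V I K * shuffle_sign V J K.
Proof.
move=> dIJ; rewrite /shuffle_sign -exprD -cardsUI.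
rewrite [X in (_ + X)%N]eq_card0 ?addn0; last first.
  move=> p; rewrite !inE; apply/negbTE/negP => /andP[/andP[pI _] /andP[pJ _]].
  by rewrite (disjointFr dIJ pI) in pJ.
by congr (_ ^+ _); apply: eq_card => p; rewrite !inE andb_orl.
Qed.

Lemma shuffle_signUr I J K : [disjoint J & K] ->
  shuffle_sign V I (J :|: K) = shuffle_sign V I J * shuffle_sign V I K.
Proof.
move=> dJK; rewrite /shuffle_sign -exprD -cardsUI.
rewrite [X in (_ + X)%N]eq_card0 ?addn0; last first.
  move=> p; rewrite !inE; apply/negbTE/negP.
  move=> /andP[/and3P[_ pJ _] /and3P[_ pK _]].
  by rewrite (disjointFr dJK pJ) in pK.
by congr (_ ^+ _); apply: eq_card => p; rewrite !inE andb_orl andb_orr.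
Qed.

Lemma shuffle_signC I J (x : V) :
  x * shuffle_sign V I J = shuffle_sign V I J * x.
Proof. exact: commr_sign. Qed.

End ShuffleSign.

(** The values at a point of [V]-valued forms on an [n]-dimensional space,
    indexed by the sets of differentials.  Under this name they carry the wedge
    product as multiplication, instead of the pointwise one. *)
Definition ext (V : Type) (n : nat) : Type := {ffun {set 'I_n} -> V}.

HB.instance Definition _ (V : zmodType) n := GRing.Zmodule.on (ext V n).

Section ExtRing.
Import fintype boot.finset.
Variables (V : pzRingType) (n : nat).
Implicit Types (a b c : ext V n).

Definition ext_mul a b : ext V n :=
  [ffun K : {set 'I_n} => \sum_(I : {set 'I_n} | I \subset K)
     shuffle_sign V I (K :\: I) * (a I * b (K :\: I))].

(** The monomial [dx_J], with the differentials in increasing order. *)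
Definition ext_basis (J : {set 'I_n}) : ext V n := [ffun I => (I == J)%:R].

Lemma ext_mulA : associative ext_mul.
Proof.
move=> a b c; apply/ffunP => K; rewrite !ffunE.
under eq_bigr => I IK do rewrite ffunE mulr_sumr mulr_sumr.
under [RHS]eq_bigr => I IK do rewrite ffunE mulr_suml mulr_sumr.
rewrite [RHS](exchange_big_dep (fun I : {set 'I_n} => I \subset K)) /=;
  last first.
  by move=> J I JK IJ; exact: subset_trans IJ JK.
apply: eq_bigr => I IK.
rewrite [RHS](reindex_onto (fun J => I :|: J) (fun J => J :\: I)) /=; last first.
  by move=> J /andP[_ IJ]; rewrite setDE setUIr setUCr setIT; apply/setUidPr.
apply: eq_big => [J|J].
  rewrite subsetUl andbT subUset IK /= setDUl setDv set0U subsetD.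
  congr (_ && _); rewrite -setI_eq0; apply/eqP/eqP => [h|<-].
    by apply/setDidPl; rewrite -setI_eq0 h.
  by rewrite setIDAC setDIl setDv setI0.
move=> /[!subsetD]/andP[JK dJI].
have dIJ : [disjoint I & J] by rewrite disjoint_sym.
have -> : (I :|: J) :\: I = J by rewrite setDUl setDv set0U; apply/setDidPl.
have -> : K :\: I :\: J = K :\: (I :|: J) by rewrite setDDl.
set L := K :\: (I :|: J).
have dJL : [disjoint J & L].
  by rewrite disjoint_sym disjoints_subset /L setDE setCU setIA subsetIr.
have -> : K :\: I = J :|: L.
  apply/setP => x; rewrite !inE negb_or.
  case xJ: (x \in J) => /=; last by rewrite andbT.
  by rewrite (disjointFr dJI xJ) (subsetP JK _ xJ).
rewrite shuffle_signUl // shuffle_signUr // -!mulrA.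
rewrite [a I * (_ * _)]mulrA shuffle_signC -!mulrA.
rewrite mulrA shuffle_signC -mulrA; congr (_ * _).
by rewrite mulrA shuffle_signC -mulrA.
Qed.

Lemma ext_mul1l : left_id (ext_basis set0) ext_mul.
Proof.
move=> a; apply/ffunP => K; rewrite !ffunE (bigD1 set0) ?sub0set //= big1.
  by rewrite addr0 ffunE eqxx mul1r setD0 shuffle_sign0l mul1r.
by move=> I /andP[_ /negbTE I0]; rewrite ffunE I0 mul0r mulr0.
Qed.

Lemma ext_mul1r : right_id (ext_basis set0) ext_mul.
Proof.
move=> a; apply/ffunP => K; rewrite !ffunE (bigD1 K) //= big1.
  by rewrite addr0 ffunE setDv eqxx mulr1 shuffle_sign0r mul1r.
move=> I /andP[IK]; rewrite eqEsubset IK /= => KI.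
by rewrite ffunE setD_eq0 (negbTE KI) !mulr0.
Qed.

Lemma ext_mulDl : left_distributive ext_mul +%R.
Proof.
move=> a b c; apply/ffunP => K; rewrite !ffunE -big_split /=.
by apply: eq_bigr => I _; rewrite !ffunE mulrDl mulrDr.
Qed.

Lemma ext_mulDr : right_distributive ext_mul +%R.
Proof.
move=> a b c; apply/ffunP => K; rewrite !ffunE -big_split /=.
by apply: eq_bigr => I _; rewrite !ffunE !mulrDr.
Qed.

HB.instance Definition _ := GRing.Zmodule_isPzRing.Build (ext V n)
  ext_mulA ext_mul1l ext_mul1r ext_mulDl ext_mulDr.

End ExtRing.

Lemma ext_one_neq0 (V : nzRingType) n : (1 : ext V n) != 0.
Proof.
apply/eqP => /ffunP/(_ finset.set0); rewrite !ffunE eqxx => /eqP.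
by rewrite oner_eq0.
Qed.

HB.instance Definition _ (V : nzRingType) n :=
  GRing.PzSemiRing_isNonZero.Build (ext V n) (ext_one_neq0 V n).

Section ExtAlgebra.
Import fintype boot.finset.
Variables (K : comNzRingType) (n : nat).
Implicit Types (a b : ext K n) (k : K) (i j : 'I_n) (I J : {set 'I_n}).

HB.instance Definition _ :=
  GRing.Lmodule.copy (ext K n) {ffun {set 'I_n} -> K^o}.

Lemma ext_scaleAl k a b : k *: (a * b) = k *: a * b.
Proof.
apply/ffunP => J; rewrite !ffunE scaler_sumr; apply: eq_bigr => I _.
by rewrite ffunE /= /GRing.scale /= -mulrA mulrCA.
Qed.

Lemma ext_scaleAr k a b : k *: (a * b) = a * (k *: b).
Proof.
apply/ffunP => J; rewrite !ffunE scaler_sumr; apply: eq_bigr => I _.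
by rewrite ffunE /= /GRing.scale /= (mulrCA k) (mulrCA k).
Qed.

HB.instance Definition _ :=
  GRing.Lmodule_isLalgebra.Build K (ext K n) ext_scaleAl.
HB.instance Definition _ :=
  GRing.Lalgebra_isAlgebra.Build K (ext K n) ext_scaleAr.

Lemma ext_scaleE k a I : (k *: a) I = k * a I.
Proof. by rewrite ffunE. Qed.

Lemma ext_basis_mul I J : [disjoint I & J] ->
  ext_basis K I * ext_basis K J = shuffle_sign K I J *: ext_basis K (I :|: J).
Proof.
move=> dIJ; apply/ffunP => L; rewrite ext_scaleE !ffunE.
have [->|LN] := eqVneq L (I :|: J).
  rewrite (bigD1 I) ?subsetUl //= big1 ?addr0 => [|I' /andP[_ /negbTE I'I]].
    have -> : (I :|: J) :\: I = J.
      by rewrite setDUl setDv set0U; apply/setDidPl; rewrite disjoint_sym.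
    by rewrite !ffunE !eqxx mulr1.
  by rewrite !ffunE I'I mul0r mulr0.
rewrite mulr0 big1 // => I' I'L; rewrite !ffunE.
case: (eqVneq I' I) => [eI|_]; last by rewrite mul0r mulr0.
case: (eqVneq (L :\: I') J) => [eJ|_]; last by rewrite !mulr0.
case/eqP: LN; rewrite -eJ -eI; apply/setP => x; rewrite !inE.
by case xI: (x \in I') => //=; rewrite (subsetP I'L).
Qed.

(** The 1-form [dx_i]. *)
Definition ext_gen i : ext K n := ext_basis K [set i].

Lemma ext_gen_sqr i : ext_gen i * ext_gen i = 0.
Proof.
apply/ffunP => L; rewrite !ffunE big1 // => I IL; rewrite !ffunE.
case: (eqVneq I [set i]) => [->|_]; last by rewrite mul0r mulr0.
case: (eqVneq (L :\: _) _) => [/setP/(_ i)|_]; last by rewrite !mulr0.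
by rewrite !inE eqxx.
Qed.

Lemma shuffle_sign1 i j : shuffle_sign K [set i] [set j] = (-1) ^+ (j < i)%N.
Proof.
rewrite /shuffle_sign; congr (_ ^+ _); case: ltnP => ij.
  rewrite -[RHS](cards1 (i, j)); apply: eq_card => -[p q]; rewrite !inE /= xpair_eqE.
  by case: eqP => [->|] //=; case: eqP => [->|].
apply: eq_card0 => -[p q]; rewrite !inE /=.
case: eqP => [->|] //=; case: eqP => [->|] //=; by rewrite ltnNge ij.
Qed.

Lemma ext_gen_anti i j : ext_gen i * ext_gen j = - (ext_gen j * ext_gen i).
Proof.
have [->|ij] := eqVneq i j; first by rewrite ext_gen_sqr oppr0.
have dij (p q : 'I_n) : p != q -> [disjoint [set p] & [set q]].
  by move=> pq; rewrite disjoints1 inE.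
rewrite !ext_basis_mul ?dij // 1?eq_sym // !shuffle_sign1 setUC -scaleNr.
congr (_ *: _).
case: (ltngtP i j) => [_|_|/val_inj/eqP]; rewrite ?expr0 ?expr1 ?opprK //.
by rewrite (negbTE ij).
Qed.

Lemma ext_gen_sorted (s : seq 'I_n) : sorted (fun i j : 'I_n => i < j)%N s ->
  \prod_(i <- s) ext_gen i = ext_basis K [set i in s].
Proof.
elim: s => [_|i s IHs ss]; first by rewrite big_nil set_nil.
have lt_tr : transitive (fun i j : 'I_n => i < j)%N.
  by move=> ? ? ?; apply: ltn_trans.
move: (ss) => /= /[dup] /path_sorted/IHs IH /(order_path_min lt_tr)/allP ile.
have iNs : i \notin s by apply/negP => /ile; rewrite ltnn.
rewrite big_cons IH ext_basis_mul ?disjoints1 ?inE // set_cons.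
rewrite /shuffle_sign eq_card0 ?scale1r // => -[p q].
rewrite !inE /=; case: eqP => //= ->; case qs: (q \in s) => //=.
by rewrite ltnNge ltnW // ile.
Qed.

Lemma enum_set_sorted I : sorted (fun i j : 'I_n => i < j)%N (enum I).
Proof.
rewrite /enum_mem; apply: sorted_filter; first by move=> ? ? ?; apply: ltn_trans.
by have := iota_ltn_sorted 0 n; rewrite -val_enum_ord sorted_map enumT.
Qed.

Lemma ext_gen_top : \prod_(i < n) ext_gen i = ext_basis K setT.
Proof.
have := ext_gen_sorted (enum_set_sorted [set: 'I_n]).
rewrite enum_setT [index_enum _]unlock => ->.
by congr ext_basis; apply/setP => i; rewrite !inE -enum_setT mem_enum inE.
Qed.

End ExtAlgebra.

(** The hypothesis [D i * D i = 0] is stated apart since it does not follow from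
    anticommutation in characteristic 2. *)
Definition anticomm (A : pzRingType) (I : Type) (D : I -> A) :=
  (forall i, D i * D i = 0) /\ (forall i j, D i * D j = - (D j * D i)).

(** The Levi-Civita symbol: the sign of [(p, l, k)] as a permutation, and 0 if
    two of the indices agree. *)
Definition eps3 (K : pzRingType) (p l k : 'I_3) : K :=
  if uniq [:: p; l; k]
  then (-1) ^+ ((l < p)%N (+) (k < p)%N (+) (k < l)%N) else 0.

Local Notation o0 := (@Ordinal 3 0 isT).
Local Notation o1 := (@Ordinal 3 1 isT).
Local Notation o2 := (@Ordinal 3 2 isT).

Section Three.
Variables (K : comNzRingType) (A : algType K).
Implicit Types D : 'I_3 -> A.

Lemma prod3E D : \prod_(i < 3) D i = D o0 * (D o1 * D o2).
Proof.
rewrite !big_ord_recl big_ord0 mulr1.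
by congr (D _ * (D _ * D _)); apply: val_inj.
Qed.

Lemma ord3P (i : 'I_3) : [\/ i = o0, i = o1 | i = o2].
Proof.
by case: i => [[|[|[|//]]]] hi; [apply: Or31|apply: Or32|apply: Or33];
  apply: val_inj.
Qed.

Lemma anticomm3 D p l k : anticomm D ->
  D p * (D l * D k) = eps3 K p l k *: \prod_(i < 3) D i.
Proof.
move=> [sq ac]; rewrite prod3E.
have sq2 i a : D i * (D i * a) = 0 by rewrite mulrA sq mul0r.
have ac2 i j a : D i * (D j * a) = - (D j * (D i * a)).
  by rewrite !mulrA ac mulNr.
move: (ac o1 o0) (ac o2 o0) (ac o2 o1) => c10 c20 c21.
move: (ac2 o1 o0) (ac2 o2 o0) (ac2 o2 o1) => c10' c20' c21'.
move: (sq o0) (sq o1) (sq o2) (sq2 o0) (sq2 o1) (sq2 o2).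
move=> s0 s1 s2 s0' s1' s2'.
case: (ord3P p) => ->; case: (ord3P l) => ->; case: (ord3P k) => ->;
  rewrite /eps3 /= ?scale0r ?expr0 ?expr1 ?scale1r ?scaleN1r;
  move: c10 c20 c21 c10' c20' c21' s0 s1 s2 s0' s1' s2';
  move: (D o0) (D o1) (D o2) => x y z c10 c20 c21 c10' c20' c21';
  move=> s0 s1 s2 s0' s1' s2'.
all: by do ?[rewrite (c10, c20, c21, c10', c20', c21')
             | rewrite (mulrN, opprK)
             | rewrite (s0, s1, s2, s0', s1', s2')
             | rewrite (oppr0, mulr0)].
Qed.

(** The permutation that interleaves the two triples is odd. *)
Lemma interleave3 (a b : 'I_3 -> A) : (forall i j, a i * b j = - (b j * a i)) ->
  \prod_(i < 3) a i * \prod_(i < 3) b i = - \prod_(i < 3) (a i * b i).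
Proof.
move=> ab; rewrite !prod3E -!mulrA.
have ab2 i j c : a i * (b j * c) = - (b j * (a i * c)).
  by rewrite !mulrA ab mulNr.
by rewrite (ab2 o2 o0) mulrN (ab2 o1 o0) opprK (ab2 o2 o1) !mulrN.
Qed.

Lemma lincomb3 (D u : 'I_3 -> A) (M : 'M[K]_3) : anticomm D ->
    (forall i, u i = \sum_j M i j *: D j) ->
  \prod_(i < 3) u i =
    (\sum_p \sum_l \sum_k M o0 p * M o1 l * M o2 k * eps3 K p l k)
      *: \prod_(i < 3) D i.
Proof.
move=> acD uE; rewrite prod3E !uE scaler_suml mulr_suml; apply: eq_bigr => p _.
rewrite scaler_suml mulr_suml [LHS]mulr_sumr; apply: eq_bigr => l _.
rewrite scaler_suml mulr_sumr mulr_sumr; apply: eq_bigr => k _.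
by rewrite -!scalerAl -!scalerAr !scalerA anticomm3 // scalerA !mulrA.
Qed.

Lemma anticomm_lincomb (I J : finType) (D : J -> A) (M N : I -> J -> K) i i' :
  (forall j j', D j * D j' = - (D j' * D j)) ->
  (\sum_j M i j *: D j) * (\sum_j N i' j *: D j) =
  - ((\sum_j N i' j *: D j) * (\sum_j M i j *: D j)).
Proof.
move=> ac; rewrite !mulr_suml -sumrN; under eq_bigr do rewrite mulr_sumr.
rewrite exchange_big /=; apply: eq_bigr => j _.
rewrite mulr_sumr -sumrN; apply: eq_bigr => j' _.
by rewrite -!scalerAl -!scalerAr ac !scalerN !scalerA mulrC.
Qed.

End Three.

Section TopCoefficient.
Variable K : comUnitRingType.
Hypothesis two_unit : (2 : K) \is a GRing.unit.

Lemma anticommP (A : algType K) (I : Type) (D : I -> A) :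
  (forall i j, D i * D j = - (D j * D i)) -> anticomm D.
Proof.
move=> ac; split=> // i; have /eqP := ac i i; rewrite -addr_eq0 -mulr2n.
rewrite -scaler_nat => /eqP h.
by rewrite -[LHS]scale1r -(mulVr two_unit) -scalerA h scaler0.
Qed.

Lemma anticomm_gen n : anticomm (@ext_gen K n).
Proof. by split; [exact: ext_gen_sqr | exact: ext_gen_anti]. Qed.

(** The determinant of a 3 x 3 matrix, as the coefficient that appears when three
    linear combinations of anticommuting elements are multiplied. *)
Definition det3 (M : 'M[K]_3) :=
  \sum_p \sum_l \sum_k M o0 p * M o1 l * M o2 k * eps3 K p l k.

(** Multiplicativity is read off the top degree of the exterior algebra, by
    changing the basis of 1-forms back and forth. *)
Lemma det3_inv (H G : 'M[K]_3) : H *m G = 1%:M -> det3 H * det3 G = 1.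
Proof.
move=> HG; have [_ acg] := anticomm_gen 3.
pose v (i : 'I_3) := \sum_j G i j *: ext_gen K j.
have acv : anticomm v.
  apply: anticommP => i j.
  exact: (@anticomm_lincomb K (ext K 3) _ _ _ (fun=> G i) (fun=> G j) i j).
have gE i : ext_gen K i = \sum_j H i j *: v j.
  under eq_bigr do rewrite scaler_sumr.
  rewrite exchange_big /= (bigD1 i) //= [X in _ + X]big1 ?addr0 => [|j ji].
    under eq_bigr do rewrite scalerA.
    rewrite -scaler_suml; have /matrixP/(_ i i) := HG.
    by rewrite !mxE eqxx => ->; rewrite scale1r.
  under eq_bigr do rewrite scalerA.
  rewrite -scaler_suml; have /matrixP/(_ i j) := HG.
  by rewrite !mxE eq_sym (negbTE ji) => ->; rewrite scale0r.
have : \prod_(i < 3) ext_gen K i =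
    (det3 H * det3 G) *: \prod_(i < 3) ext_gen K i.
  rewrite {1}(lincomb3 acv gE) -scalerA; congr (_ *: _).
  by rewrite (@lincomb3 K (ext K 3) (@ext_gen K 3) v G) //; exact: anticomm_gen.
move=> /ffunP/(_ [set: 'I_3]).
by rewrite ext_scaleE ext_gen_top ffunE eqxx mulr1.
Qed.

(** With [eta_k = \sum_j G k j *: y j] and [th_k = x_k + iota *: eta_k], each
    [dz j] is a combination of the [th_k] with matrix [H], while
    [D k = (x_k - iota *: eta_k) / 2].  The products [th_k * D k] are
    [- iota *: (x_k * eta_k)], and the two Jacobians [det3 H] and [det3 G]
    cancel. *)
Lemma holomorphic_antiholomorphic_top (A : algType K) (iota : K)
    (x y : 'I_3 -> A) (H G : 'M[K]_3) (dz D : 'I_3 -> A) :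
    iota * iota = -1 -> H *m G = 1%:M ->
    anticomm x -> anticomm y -> (forall i j, x i * y j = - (y j * x i)) ->
    (forall j, dz j = \sum_k H j k *: x k + iota *: y j) ->
    (forall k, D k = 2^-1 *: (x k - iota *: \sum_j G k j *: y j)) ->
  \prod_(j < 3) dz j * \prod_(k < 3) D k =
    iota *: (\prod_(i < 3) x i * \prod_(i < 3) y i).
Proof.
move=> i2 HG [sqx acx] [sqy acy] xy dzE DE.
pose eta k := \sum_j G k j *: y j.
pose th k := x k + iota *: eta k.
have xeta i j : x i * eta j = - (eta j * x i).
  rewrite mulr_sumr mulr_suml -sumrN; apply: eq_bigr => k _.
  by rewrite -scalerAr -scalerAl xy scalerN.
have etax i j : eta i * x j = - (x j * eta i) by rewrite xeta opprK.
have aceta i j : eta i * eta j = - (eta j * eta i).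
  exact: (@anticomm_lincomb K A _ _ _ (fun=> G i) (fun=> G j) i j).
have [sqeta _] := anticommP aceta.
have acth : anticomm th.
  apply: anticommP => i j; rewrite /th !mulrDl !mulrDr -!scalerAl -!scalerAr.
  rewrite acx xeta aceta !opprD -!scalerN xeta opprK !scalerN !addrA.
  by congr (_ + _); rewrite addrAC.
have dzth j : dz j = \sum_k H j k *: th k.
  rewrite dzE; under [RHS]eq_bigr do rewrite scalerDr.
  rewrite big_split /=; congr (_ + _).
  under [RHS]eq_bigr do rewrite scalerA mulrC -scalerA.
  rewrite -scaler_sumr; congr (_ *: _).
  under [RHS]eq_bigr do rewrite scaler_sumr.
  rewrite exchange_big /= (bigD1 j) //= [X in _ + X]big1 ?addr0 => [|i ij].
    under eq_bigr do rewrite scalerA.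
    rewrite -scaler_suml; have /matrixP/(_ j j) := HG.
    by rewrite !mxE eqxx => ->; rewrite scale1r.
  under eq_bigr do rewrite scalerA.
  rewrite -scaler_suml; have /matrixP/(_ j i) := HG.
  by rewrite !mxE eq_sym (negbTE ij) => ->; rewrite scale0r.
have thD i j : th i * D j = - (D j * th i).
  rewrite DE -/(eta j) -scalerAr -scalerAl -[RHS]scalerN; congr (_ *: _).
  rewrite /th !mulrDl !mulrDr !mulrN !mulNr -!scalerAl -!scalerAr.
  rewrite (acx i j) (aceta i j) !etax.
  by rewrite !scalerN !opprD !opprK !addrA; congr (_ + _); rewrite addrAC.
have diag k : th k * D k = - iota *: (x k * eta k).
  rewrite DE -/(eta k) -scalerAr /th !mulrDl !mulrDr !mulrN.
  rewrite -!scalerAl -!scalerAr.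
  rewrite sqx sqeta !scaler0 oppr0 addr0 add0r etax.
  rewrite scalerN -opprD -mulr2n scalerN scaleNr -scaler_nat scalerA mulVr //.
  by rewrite scale1r.
rewrite (lincomb3 acth dzth) -/(det3 H) -scalerAl interleave3 //.
have -> : \prod_(i < 3) (th i * D i) =
    iota *: - (\prod_(i < 3) x i * \prod_(i < 3) eta i).
  rewrite interleave3 // opprK; under eq_bigr do rewrite diag.
  rewrite !prod3E -!scalerAl -!scalerAr !scalerA; congr (_ *: _).
  by rewrite mulrNN i2 mulrN1 opprK.
have yG k : eta k = \sum_j G k j *: y j by [].
rewrite (lincomb3 (conj sqy acy) yG) -/(det3 G) -scalerAr !scalerN opprK !scalerA.
by rewrite mulrAC (det3_inv HG) mul1r.
Qed.

End TopCoefficient.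

(** * Matrix-valued forms at a point *)

Local Open Scope complex_scope.

Section Tens.
Variables (K : comNzRingType) (n r : nat).
Implicit Types (u v : ext K n) (g h : 'M[K]_r).

(** The matrix-valued form [u . g], for a scalar form [u] and a matrix [g]. *)
Definition tens u g : ext 'M[K]_r n := [ffun I => u I *: g].

Lemma tensDl u v g : tens (u + v) g = tens u g + tens v g.
Proof. by apply/ffunP => I; rewrite !ffunE scalerDl. Qed.

Lemma tensDr u g h : tens u (g + h) = tens u g + tens u h.
Proof. by apply/ffunP => I; rewrite !ffunE scalerDr. Qed.

Lemma tens0l g : tens 0 g = 0.
Proof. by apply/ffunP => I; rewrite !ffunE scale0r. Qed.

Lemma tens0r u : tens u 0 = 0.
Proof. by apply/ffunP => I; rewrite !ffunE scaler0. Qed.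

Lemma tensZ k u g : tens (k *: u) g = tens u (k *: g).
Proof. by apply/ffunP => I; rewrite !ffunE scalerA mulrC. Qed.

Lemma tens_suml (J : finType) (P : pred J) (u : J -> ext K n) g :
  tens (\sum_(j | P j) u j) g = \sum_(j | P j) tens (u j) g.
Proof.
apply: (big_morph (fun u => tens u g)) => [? ?|]; first exact: tensDl.
exact: tens0l.
Qed.

Lemma tens_sumr (J : finType) (P : pred J) u (g : J -> 'M[K]_r) :
  tens u (\sum_(j | P j) g j) = \sum_(j | P j) tens u (g j).
Proof.
by apply: (big_morph (tens u)) => [? ?|]; [exact: tensDr|exact: tens0r].
Qed.

Lemma tens_mul u v g h : tens u g * tens v h = tens (u * v) (g *m h).
Proof.
apply/ffunP => I; rewrite !ffunE scaler_suml; apply: eq_bigr => J _.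
have sgnE (V : pzRingType) (a : V) : shuffle_sign V J (I :\: J) * a =
    if odd #|[set p : 'I_n * 'I_n |
              [&& p.1 \in J, p.2 \in I :\: J & (p.2 < p.1)%N]]|
    then - a else a.
  by rewrite /shuffle_sign -signr_odd mulr_sign.
rewrite !ffunE !sgnE.
have -> : u J *: g * (v (I :\: J) *: h) = (u J * v (I :\: J)) *: (g *m h).
  by rewrite -[LHS]/(_ *m _) -scalemxAl -scalemxAr scalerA.
by case: odd; rewrite ?scaleNr.
Qed.

Lemma tr_tens u g I : \tr (tens u g I) = \tr g * u I.
Proof. by rewrite ffunE mxtraceZ mulrC. Qed.

Variable D : 'I_n -> ext K n.

(** The degree [q] part of [u] after the substitution of [D i] for [dx_i].
    When [D i] is the (0,1)-part of [dx_i], this is the (0,q)-part of [u]. *)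
Definition sproj q u : ext K n :=
  \sum_(I : {set 'I_n} | #|I| == q) u I *: \prod_(i <- enum I) D i.

(** The same substitution on matrix-valued forms. *)
Definition mproj q (w : ext 'M[K]_r n) : ext 'M[K]_r n :=
  \sum_(I : {set 'I_n} | #|I| == q) tens (\prod_(i <- enum I) D i) (w I).

Lemma mproj_tens q u g : mproj q (tens u g) = tens (sproj q u) g.
Proof.
by rewrite tens_suml; apply: eq_bigr => I _; rewrite ffunE tensZ.
Qed.

Lemma mproj_sum (J : finType) (P : pred J) q (w : J -> ext 'M[K]_r n) :
  mproj q (\sum_(j | P j) w j) = \sum_(j | P j) mproj q (w j).
Proof.
apply: (big_morph (mproj q)) => [v w'|].
  by rewrite -big_split; apply: eq_bigr => I _; rewrite ffunE tensDr.
by rewrite /mproj big1 // => I _; rewrite ffunE tens0r.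
Qed.

Lemma sproj_basis (J : {set 'I_n}) :
  sproj #|J| (ext_basis K J) = \prod_(i <- enum J) D i.
Proof.
rewrite /sproj (bigD1 J) //= [X in _ + X]big1 => [|I /andP[_ /negbTE IJ]].
  by rewrite addr0 ffunE eqxx scale1r.
by rewrite ffunE IJ scale0r.
Qed.

Lemma sproj1 i : sproj 1 (ext_gen K i) = D i.
Proof.
have := sproj_basis [set i]; rewrite cards1 => ->.
by rewrite enum_set1 big_seq1.
Qed.

Lemma sproj2 i j : anticomm D ->
  sproj 2 (ext_gen K i * ext_gen K j) = D i * D j.
Proof.
move=> [sqD acD].
have sprojN q u : sproj q (- u) = - sproj q u.
  by rewrite -sumrN; apply: eq_bigr => I _; rewrite ffunE scaleNr.
wlog ij : i j / (i <= j)%N.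
  move=> H; case/orP: (leq_total i j) => [/H//|/H ji].
  by rewrite ext_gen_anti sprojN ji -acD.
have [->|inj] := eqVneq i j.
  rewrite ext_gen_sqr sqD /sproj big1 // => I _.
  by rewrite ffunE scale0r.
have {}ij : (i < j)%N by rewrite ltn_neqAle ij andbT.
have s : sorted (fun i j : 'I_n => i < j)%N [:: i; j] by rewrite /= ij.
have := ext_gen_sorted K s; rewrite big_cons big_seq1 => ->.
set J := finset.finset _.
have cJ : #|J| = 2%N.
  have /card_uniqP sz : uniq [:: i; j] by rewrite /= inE inj.
  by rewrite cardsE sz.
have := sproj_basis J; rewrite cJ => ->; have -> : enum J = [:: i; j].
  apply: (@irr_sorted_eq _ (fun i j : 'I_n => i < j)%N) => //.
  - by move=> ? ? ?; apply: ltn_trans.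
  - by move=> ?; rewrite /= ltnn.
  - exact: enum_set_sorted.
  - by move=> k; rewrite mem_enum inE.
by rewrite big_cons big_seq1.
Qed.

End Tens.

Section FormsPointwise.
Variables (R : realType) (n : nat).
Local Notation C := R[i].
Implicit Types (x : 'rV[R]_n).

Lemma wedgeE (V : pzRingType) (a b : Defs.form R n V) x :
  wedge a b x = (a x : ext V n) * (b x : ext V n).
Proof. by []. Qed.

Lemma wedgesE (s : seq (Defs.form R n C)) x :
  wedges s x = \prod_(w <- s) (w x : ext C n).
Proof.
elim: s => [|w s IHs]; last by rewrite big_cons -IHs.
rewrite big_nil; apply/ffunP => I; rewrite !ffunE.
by case: ifP => _.
Qed.

Lemma extd_withE (V : pzRingType)
    (D : 'I_n -> ('rV[R]_n -> V) -> 'rV[R]_n -> V) (w : Defs.form R n V) x :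
  extd_with D w x =
  \sum_(i < n) (dcoord V i x : ext V n) * [ffun I => D i (fun y => w y I) x].
Proof. by rewrite /extd_with fct_sumE. Qed.

Lemma cpartial_cst (i : 'I_n) (c : C) x : cpartial i (fun=> c) x = 0.
Proof. by rewrite /cpartial /partial !derive_cst. Qed.

Lemma dfunE (g : 'rV[R]_n -> C) x :
  dfun g x = \sum_(i < n) cpartial i g x *: ext_gen C i :> ext C n.
Proof.
rewrite /dfun /extd extd_withE; apply: eq_bigr => i _.
have -> : [ffun I => cpartial i (fun y => form0 g y I) x] =
          cpartial i g x *: (1 : ext C n).
  apply/ffunP => I; rewrite ext_scaleE !ffunE.
  have [->|I0] := eqVneq I finset.set0.
    rewrite mulr1; congr cpartial; apply/funext => y.
    by rewrite ffunE eqxx.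
  rewrite mulr0; transitivity (cpartial i (fun=> 0 : C) x);
    last exact: cpartial_cst.
  by congr cpartial; apply/funext => y; rewrite ffunE (negbTE I0).
by rewrite -scalerAr mulr1.
Qed.

Lemma form_mxE r (w : Defs.form R n C) (g : 'rV[R]_n -> 'M[C]_r) x :
  form_mx w g x = tens (w x) (g x).
Proof. by []. Qed.

End FormsPointwise.

(** * Derivatives *)

Local Open Scope classical_set_scope.
Local Open Scope ring_scope.
Local Open Scope complex_scope.

Section AffineComposition.
Variables (R : realType) (U V : normedModType R).

Lemma growth_rate_comp_affine (g : V -> R) (a : U -> V) s u v :
  (forall h : R, a (h *: u + s) = h *: v + a s) ->
  (fun h : R => h^-1 *: (((g \o a) \o shift s) (h *: u) - (g \o a) s)) =
  (fun h : R => h^-1 *: ((g \o shift (a s)) (h *: v) - g (a s))).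
Proof. by move=> aE; apply/funext => h /=; rewrite aE. Qed.

Lemma derive_comp_affine (g : V -> R) (a : U -> V) s u v :
  (forall h : R, a (h *: u + s) = h *: v + a s) ->
  'D_u (g \o a) s = 'D_v g (a s).
Proof. by move=> aE; rewrite /derive (growth_rate_comp_affine g aE). Qed.

Lemma derivable_comp_affine (g : V -> R) (a : U -> V) s u v :
  (forall h : R, a (h *: u + s) = h *: v + a s) ->
  derivable (g \o a) s u = derivable g (a s) v.
Proof. by move=> aE; rewrite /derivable (growth_rate_comp_affine g aE). Qed.

End AffineComposition.

(** Two reals [p] and [q] with multiples close to the same [a] are close. *)
Lemma dist_le_common_approx (R : realType) (a k p q e : R) : 0 < k ->
  `|a - k * p| <= e / 2 * k -> `|a - k * q| <= e / 2 * k -> `|p - q| <= e.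
Proof.
move=> k0 H1 H2; rewrite -(ler_pM2l k0) -{1}(gtr0_norm k0) -normrM.
have -> : k * (p - q) = (a - k * q) - (a - k * p) by ring.
by apply: (le_trans (ler_normB _ _)); lra.
Qed.

(** Here [A] and [B] are values of a function near a point where it takes the
    value [F0], with first order expansions [dv + h * dw] and [dv]. *)
Lemma mean_value_bound (R : realType) (A B F0 dv dw h k n1 n2 N : R) :
    0 < h -> 0 <= k ->
    `|A - F0 - (dv + h * dw)| <= k * n1 -> `|B - F0 - dv| <= k * n2 ->
    n1 + n2 <= h * N ->
  `|(A - B) * h - h ^+ 2 * dw| <= k * N * h ^+ 2.
Proof.
move=> h0 k0 H1 H2 n12.
have -> : (A - B) * h - h ^+ 2 * dw =
  h * ((A - F0 - (dv + h * dw)) - (B - F0 - dv)) by ring.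
rewrite normrM gtr0_norm //.
have -> : k * N * h ^+ 2 = h * (k * (h * N)) by ring.
rewrite ler_pM2l //; apply: (le_trans (ler_normB _ _)).
apply: le_trans (_ : k * (n1 + n2) <= _); last exact: ler_wpM2l.
by rewrite mulrDr lerD.
Qed.

Section Schwarz.
Variables (R : realType) (V : normedModType R).
Implicit Types (g : V -> R) (x v w : V).

Lemma differentiable_expansion g x (eps : R) : 0 < eps -> differentiable g x ->
  exists2 d : R, 0 < d &
    forall u, `|u| < d -> `|g (x + u) - g x - 'D_u g x| <= eps * `|u|.
Proof.
move=> e0 dg; have [_ /eqaddoP/(_ _ e0)] := iffLR (diff_locallyP _ _) dg.
move=> /nbhs_norm0P[d /= d0 H]; exists d => // u ud.
have := H u ud; rewrite !fctE /= deriveE // opprD addrA.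
by rewrite [u + x]addrC.
Qed.

Lemma is_derive_line g x v (s : R) : differentiable g (x + s *: v) ->
  is_derive s 1 (fun t : R => g (x + t *: v)) ('D_v g (x + s *: v)).
Proof.
move=> dg.
have aE (h : R) : x + (h *: 1 + s) *: v = h *: v + (x + s *: v).
  by rewrite [h *: 1]mulr1 scalerDl addrCA.
split.
  rewrite -[fun t : R => _]/(g \o (fun t : R => x + t *: v)).
  by rewrite (derivable_comp_affine g aE); exact: diff_derivable.
rewrite -[fun t : R => _]/(g \o (fun t : R => x + t *: v)).
exact: (derive_comp_affine g aE).
Qed.

(** Symmetric in [v] and [w].  Divided by the square of the step, it approximates
    both mixed second derivatives at [x] ([second_difference_approx]). *)
Definition second_difference g x v w :=
  g (x + v + w) - g (x + v) - g (x + w) + g x.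

Lemma second_differenceC g x v w :
  second_difference g x v w = second_difference g x w v.
Proof. by rewrite /second_difference (addrAC x v w); ring. Qed.

Lemma deriveZv g x (k : R) v : differentiable g x ->
  'D_(k *: v) g x = k * 'D_v g x.
Proof. by move=> dg; rewrite !deriveE // linearZ. Qed.

Lemma deriveDv g x v w : differentiable g x ->
  'D_(v + w) g x = 'D_v g x + 'D_w g x.
Proof. by move=> dg; rewrite !deriveE // linearD. Qed.

Lemma second_difference_approx g x v w (eps : R) : 0 < eps ->
    (\forall y \near x, differentiable g y) -> differentiable ('D_v g) x ->
  exists2 d : R, 0 < d & forall h, 0 < h < d ->
    `|second_difference g x (h *: v) (h *: w) - h ^+ 2 * 'D_w ('D_v g) x|
      <= eps * h ^+ 2.
Proof.
move=> e0 /nbhs_normP[d1 /= d10 dg] dF.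
(* [h * N] bounds the sum of the norms of [c *: v + h *: w] and [c *: v]. *)
set N := 2 * `|v| + `|w| + 1.
have N0 : 0 < N by rewrite ltr_wpDl // addr_ge0 // mulr_ge0.
have eN0 : 0 < eps / N by rewrite divr_gt0.
have [d2 d20 dE] := differentiable_expansion eN0 dF.
exists (Num.min d1 d2 / N) => [|h /andP[h0]].
  by rewrite divr_gt0 // lt_min d10.
rewrite ltr_pdivlMr // lt_min => /andP[hd1 hd2].
have small (t s : R) : 0 <= t <= h -> 0 <= s <= h ->
    `|t *: v + s *: w| < Num.min d1 d2.
  move=> /andP[t0 th] /andP[s0 sh].
  apply: le_lt_trans (_ : h * (`|v| + `|w|) < _).
    rewrite (le_trans (ler_normD _ _)) // !normrZ !ger0_norm // mulrDr lerD //.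
      by rewrite ler_wpM2r.
    by rewrite ler_wpM2r.
  apply: le_lt_trans (_ : h * N < _); last by rewrite lt_min hd1 hd2.
  rewrite ler_wpM2l ?(ltW h0) // /N; have := normr_ge0 v; lra.
have hh : 0 <= h <= h by rewrite ltW //=.
have h00 : 0 <= (0 : R) <= h by rewrite lexx ltW.
pose psi (t : R) := g (x + h *: w + t *: v) - g (x + t *: v).
pose dpsi (t : R) := 'D_v g (x + h *: w + t *: v) - 'D_v g (x + t *: v).
have dpsiP t : t \in `[0, h] -> is_derive t 1 psi (dpsi t).
  rewrite in_itv /= => th.
  apply: is_deriveB; apply: is_derive_line; apply: dg => /=.
    rewrite -addrA opprD addNKr normrN addrC.
    by have := small _ _ th hh; rewrite lt_min => /andP[].
  rewrite opprD addNKr normrN.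
  by have := small _ _ th h00; rewrite scale0r addr0 lt_min => /andP[].
have cpsi : {within `[0, h], continuous psi}.
  by apply: derivable_within_continuous => t /dpsiP[].
have dpsiP' t : t \in `]0, h[ -> is_derive t 1 psi (dpsi t).
  move=> th; apply: dpsiP; move: th; rewrite !in_itv /= => /andP[t0 th].
  by rewrite !ltW.
(* The second difference is the increment of [psi] over [0, h]. *)
have [c] := MVT h0 dpsiP' cpsi.
rewrite in_itv /= => /andP[c0 ch].
have {ch} hc : 0 <= c <= h by rewrite !ltW.
have -> : psi h - psi 0 = second_difference g x (h *: v) (h *: w).
  rewrite /psi /second_difference !scale0r !addr0 (addrAC x (h *: w)); ring.
rewrite subr0 => ->.
have sm1 := small _ _ hc hh; have sm2 := small _ _ hc h00.
have E1 := dE (c *: v + h *: w); have E2 := dE (c *: v).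
rewrite {}scale0r addr0 in sm2.
have {E1} := E1 (lt_le_trans sm1 _).
rewrite ge_min lexx orbT => /(_ isT).
have {E2} := E2 (lt_le_trans sm2 _).
rewrite ge_min lexx orbT => /(_ isT).
rewrite deriveDv // (deriveZv h) // => E2 E1.
have n12 : `|c *: v + h *: w| + `|c *: v| <= h * N.
  have /andP[_ ch] := hc.
  have nv : `|c *: v| <= h * `|v| by rewrite normrZ gtr0_norm // ler_wpM2r.
  have nw : `|h *: w| = h * `|w| by rewrite normrZ gtr0_norm.
  have := ler_normD (c *: v) (h *: w); rewrite nw /N !mulrDr mulr1 => ?.
  by rewrite mulrCA; lra.
have eE : eps / N * N = eps by rewrite divfK // gt_eqF.
rewrite /dpsi -addrA [h *: w + _]addrC -eE.
move: E1 E2 n12; apply: mean_value_bound => //; exact: ltW.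
Qed.

(** Symmetry of second derivatives, when the two first derivatives are
    differentiable at the point (no continuity of the second derivatives). *)
Theorem schwarz g x v w :
    (\forall y \near x, differentiable g y) ->
    differentiable ('D_v g) x -> differentiable ('D_w g) x ->
  'D_w ('D_v g) x = 'D_v ('D_w g) x.
Proof.
move=> dg dv dw; apply/eqP; rewrite -subr_eq0 -normr_le0.
apply/ler_addgt0Pl => e e0; rewrite addr0.
have e2 : 0 < e / 2 by rewrite divr_gt0.
have [d1 d10 H1] := second_difference_approx w e2 dg dv.
have [d2 d20 H2] := second_difference_approx v e2 dg dw.
pose h := Num.min d1 d2 / 2.
have m0 : 0 < Num.min d1 d2 by rewrite lt_min d10.
have h0 : 0 < h by rewrite divr_gt0.
have hm : h < Num.min d1 d2.
  by rewrite ltr_pdivrMr // mulr2n mulrDr mulr1 ltrDl.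
have := hm; rewrite lt_min => /andP[hd1 hd2].
have {H1} := H1 h; rewrite h0 hd1 => /(_ isT) H1.
have {H2} := H2 h; rewrite h0 hd2 => /(_ isT).
rewrite second_differenceC => H2.
have h20 : 0 < h ^+ 2 by rewrite exprn_gt0.
exact: dist_le_common_approx H1 H2.
Qed.

End Schwarz.

Section BigDerivable.
Variables (R : realType) (V : normedModType R) (x v : V).

Lemma derivable_bigsum (J : Type) (s : seq J) (P : pred J) (f : J -> V -> R) :
  (forall j, derivable (f j) x v) ->
  derivable (fun y => \sum_(j <- s | P j) f j y) x v.
Proof.
move=> df; elim: s => [|j s IHs].
  by under eq_fun do rewrite big_nil; exact: derivable_cst.
under eq_fun do rewrite big_cons.
by case: (P j); [exact: (derivableD (df j) IHs) | exact: IHs].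
Qed.

Lemma derivable_bigprod (J : Type) (s : seq J) (P : pred J) (f : J -> V -> R) :
  (forall j, derivable (f j) x v) ->
  derivable (fun y => \prod_(j <- s | P j) f j y) x v.
Proof.
move=> df; elim: s => [|j s IHs].
  by under eq_fun do rewrite big_nil; exact: derivable_cst.
under eq_fun do rewrite big_cons.
by case: (P j); [exact: (derivableM (df j) IHs) | exact: IHs].
Qed.

Lemma derivable_det n (M : V -> 'M[R]_n) :
  (forall i j, derivable (fun y => M y i j) x v) ->
  derivable (fun y => \det (M y)) x v.
Proof.
move=> dM; apply: derivable_bigsum => s.
by apply: derivableM; [exact: derivable_cst | exact: derivable_bigprod].
Qed.

(** By Cramer's rule. *)
Lemma derivable_invmx n (M : V -> 'M[R]_n) :
    (forall i j, derivable (fun y => M y i j) x v) ->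
    (\forall y \near x, M y \in unitmx) ->
  forall i j, derivable (fun y => invmx (M y) i j) x v.
Proof.
move=> dM uM i j.
apply: (@near_eq_derivable _ _ _
  (fun y => (\det (M y))^-1 *
     ((-1) ^+ (j + i) * \det (row' j (col' i (M y)))))).
  by apply: filterS uM => y My; rewrite /invmx My !mxE.
apply: derivableM; last first.
  apply: derivableM; first exact: derivable_cst.
  apply: derivable_det => a b.
  by under eq_fun do rewrite !mxE; exact: dM.
apply: derivableV; last exact: derivable_det.
by have := nbhs_singleton uM; rewrite unitmxE unitfE.
Qed.

End BigDerivable.

Section ComplexDerivative.
Variables (R : realType) (n : nat).
Local Notation C := R[i].
Implicit Types (f g : 'rV[R]_n -> C) (x : 'rV[R]_n).

(** [d] is the partial derivative of the complex function [f] at [x], and its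
    real and imaginary parts are derivable there. *)
Definition is_cpartial (i : 'I_n) f x (d : C) :=
  is_derive x (delta_mx 0 i : 'rV[R]_n)
    (fun y => complex.Re (f y)) (complex.Re d) /\
  is_derive x (delta_mx 0 i : 'rV[R]_n)
    (fun y => complex.Im (f y)) (complex.Im d).

Lemma is_cpartialE i f x d : is_cpartial i f x d -> cpartial i f x = d.
Proof.
move=> [[_ dr] [_ di]]; rewrite /cpartial /partial dr di.
by case: d {dr di}.
Qed.

Lemma is_cpartial_cst i (c : C) x : is_cpartial i (fun=> c) x 0.
Proof. by split; exact: is_derive_cst. Qed.

Lemma is_cpartialD i f g x d e : is_cpartial i f x d -> is_cpartial i g x e ->
  is_cpartial i (fun y => f y + g y) x (d + e).
Proof.
move=> [fr fi] [gr gi]; split.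
  have -> : (fun y => complex.Re (f y + g y)) =
      (fun y => complex.Re (f y)) + (fun y => complex.Re (g y)).
    by apply/funext => y /=; rewrite !fctE raddfD.
  by rewrite raddfD; exact: is_deriveD.
have -> : (fun y => complex.Im (f y + g y)) =
    (fun y => complex.Im (f y)) + (fun y => complex.Im (g y)).
  by apply/funext => y /=; rewrite !fctE raddfD.
by rewrite raddfD; exact: is_deriveD.
Qed.

Lemma is_cpartialM i f g x d e : is_cpartial i f x d -> is_cpartial i g x e ->
  is_cpartial i (fun y => f y * g y) x (f x * e + d * g x).
Proof.
have ReM (a b : C) : complex.Re (a * b) =
    complex.Re a * complex.Re b - complex.Im a * complex.Im b.
  by case: a b => [a a'] [b b'].
have ImM (a b : C) : complex.Im (a * b) =
    complex.Re a * complex.Im b + complex.Im a * complex.Re b.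
  by case: a b => [a a'] [b b'].
have ReD (a b : C) : complex.Re (a + b) = complex.Re a + complex.Re b.
  by case: a b => [a a'] [b b'].
have ImD (a b : C) : complex.Im (a + b) = complex.Im a + complex.Im b.
  by case: a b => [a a'] [b b'].
move=> [fr fi] [gr gi]; split.
  have -> : (fun y => complex.Re (f y * g y)) =
     (fun y => complex.Re (f y)) * (fun y => complex.Re (g y)) -
     (fun y => complex.Im (f y)) * (fun y => complex.Im (g y)).
    by apply/funext => y /=; rewrite ReM.
  apply: is_derive_eq; rewrite ReD !ReM /GRing.scale /=; ring.
have -> : (fun y => complex.Im (f y * g y)) =
     (fun y => complex.Re (f y)) * (fun y => complex.Im (g y)) +
     (fun y => complex.Im (f y)) * (fun y => complex.Re (g y)).
  by apply/funext => y /=; rewrite ImM.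
apply: is_derive_eq; rewrite ImD !ImM /GRing.scale /=; ring.
Qed.

Lemma is_cpartial_sum i (J : Type) (s : seq J) (f : J -> 'rV[R]_n -> C)
    (d : J -> C) x :
  (forall j, is_cpartial i (f j) x (d j)) ->
  is_cpartial i (fun y => \sum_(j <- s) f j y) x (\sum_(j <- s) d j).
Proof.
move=> df; elim: s => [|j s IHs].
  by under eq_fun do rewrite big_nil; rewrite big_nil; exact: is_cpartial_cst.
by under eq_fun do rewrite big_cons; rewrite big_cons; exact: is_cpartialD.
Qed.

Lemma near_eq_cpartial i f g x : (\forall y \near x, f y = g y) ->
  cpartial i f x = cpartial i g x.
Proof.
by move=> fg; rewrite /cpartial /partial;
  congr (_ +i* _); apply: near_eq_derive; apply: filterS fg => y ->.
Qed.

Lemma is_cpartial_real i (f : 'rV[R]_n -> R) x :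
  derivable f x (delta_mx 0 i) ->
  is_cpartial i (fun y => (f y)%:C) x (partial i f x)%:C.
Proof. by move=> df; split; [exact: derivableP | exact: is_derive_cst]. Qed.

End ComplexDerivative.

Section SubVector.
Variables (R : realType) (m : nat).
Implicit Types (p : 'rV[R]_(m + m)).

Lemma open_ball_near (a : 'rV[R]_m) rho x : open_ball a rho x ->
  \forall y \near x, open_ball a rho y.
Proof.
move=> xB.
have : continuous (fun y : 'rV[R]_m => \sum_(j < m) (y 0 j - a 0 j) ^+ 2).
  move=> y; apply: differentiable_continuous.
  have -> : (fun y : 'rV[R]_m => \sum_(j < m) (y 0 j - a 0 j) ^+ 2) =
    \sum_(j < m) (fun y : 'rV[R]_m => (y 0 j - a 0 j) ^+ 2).
    by apply/funext => z; rewrite fct_sumE.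
  apply: differentiable_sum => j.
  pose f (y : 'rV[R]_m) := y 0 j - a 0 j.
  have df : differentiable f y.
    apply: differentiableB; first exact: differentiable_coord.
    exact: differentiable_cst.
  exact: (@differentiableM _ _ f f).
move=> /(_ x) cx; apply: (cx [set r | r < rho ^+ 2]).
by apply: open_nbhs_nbhs; split => //; exact: open_lt.
Qed.

Lemma open_ball_near_lsubmx (a : 'rV[R]_m) rho p :
  open_ball a rho (lsubmx p) -> \forall q \near p, open_ball a rho (lsubmx q).
Proof.
move=> /open_ball_near H.
have c := differentiable_continuous (@differentiable_lsubmx R 1 m m p).
exact: c H.
Qed.

Lemma lsubmx_shift p (u : 'rV[R]_(m + m)) (h : R) :
  lsubmx (h *: u + p) = h *: lsubmx u + lsubmx p.
Proof. by rewrite linearP. Qed.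

Lemma lsubmx_delta_l (k : 'I_m) :
  lsubmx (delta_mx 0 (lshift m k)) = delta_mx 0 k :> 'rV[R]_m.
Proof. by apply/rowP => j; rewrite !mxE /= eq_lshift. Qed.

Lemma lsubmx_delta_r (k : 'I_m) :
  lsubmx (delta_mx 0 (rshift m k)) = 0 :> 'rV[R]_m.
Proof. by apply/rowP => j; rewrite !mxE /= eq_lrshift. Qed.

Lemma partial_lsubmx_l (k : 'I_m) (g : 'rV[R]_m -> R) p :
  partial (lshift m k) (fun q => g (lsubmx q)) p = partial k g (lsubmx p).
Proof.
rewrite /partial -lsubmx_delta_l.
by apply: (@derive_comp_affine _ _ _ g) => h; exact: lsubmx_shift.
Qed.

Lemma partial_lsubmx_r (k : 'I_m) (g : 'rV[R]_m -> R) p :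
  partial (rshift m k) (fun q => g (lsubmx q)) p = 0.
Proof.
rewrite /partial -(derive0 g (lsubmx p)) -(lsubmx_delta_r k).
by apply: (@derive_comp_affine _ _ _ g) => h; exact: lsubmx_shift.
Qed.

Lemma derivable_lsubmx (u : 'rV[R]_(m + m)) (g : 'rV[R]_m -> R) p :
  derivable (fun q => g (lsubmx q)) p u = derivable g (lsubmx p) (lsubmx u).
Proof.
by apply: (@derivable_comp_affine _ _ _ g) => h; exact: lsubmx_shift.
Qed.

Lemma partial_rsubmx (i : 'I_(m + m)) (j : 'I_m) p :
  partial i (fun q => rsubmx q 0 j) p = (i == rshift m j)%:R.
Proof.
have aE (h : R) : rsubmx (h *: delta_mx 0 i + p) 0 j =
    h *: (i == rshift m j)%:R + rsubmx p 0 j.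
  by rewrite !mxE eqxx /= eq_sym.
rewrite /partial -[LHS]/('D_(delta_mx 0 i) (id \o (fun q => rsubmx q 0 j)) p).
by rewrite (derive_comp_affine id aE) derive_id.
Qed.

End SubVector.

(** * Exterior derivative and type decomposition *)

Section ExteriorDerivative.
Variables (R : realType) (n r : nat).
Local Notation C := R[i].
Implicit Types (x : 'rV[R]_n).

Lemma near_eq_mxpartial i (f g : 'rV[R]_n -> 'M[C]_r) x :
  (\forall y \near x, f y = g y) -> mxpartial i f x = mxpartial i g x.
Proof.
move=> fg; apply/matrixP => a b; rewrite !mxE; apply: near_eq_cpartial.
by apply: filterS fg => y ->.
Qed.

(** A form that is a 1-form only near [x] is differentiated through its
    coefficients [G j]. *)
Lemma mxextd_one_form (w : Defs.form R n 'M[C]_r)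
    (G : 'I_n -> 'rV[R]_n -> 'M[C]_r) x :
    (\forall y \near x, w y = \sum_j tens (ext_gen C j) (G j y)) ->
  mxextd w x =
    \sum_l \sum_j tens (ext_gen C l * ext_gen C j) (mxpartial l (G j) x).
Proof.
move=> wG; rewrite /mxextd extd_withE; apply: eq_bigr => l _.
have -> : dcoord 'M[C]_r l x = tens (ext_gen C l) 1%:M.
  apply/ffunP => I; rewrite !ffunE; case: eqP => _; last by rewrite scale0r.
  by rewrite scale1r.
suff -> : [ffun I => mxpartial l (fun y => w y I) x] =
    \sum_j tens (ext_gen C j) (mxpartial l (G j) x).
  by rewrite mulr_sumr; apply: eq_bigr => j _; rewrite tens_mul mul1mx.
apply/ffunP => I; rewrite ffunE sum_ffunE.
have wI : \forall y \near x, w y I = \sum_j (I == [set j]%SET)%:R *: G j y.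
  apply: filterS wG => y ->; rewrite sum_ffunE.
  by apply: eq_bigr => j _; rewrite !ffunE.
rewrite (near_eq_mxpartial l wI).
have [[j ->]|noj] := pselect (exists j, I = [set j]%SET).
  have sum1 (F : 'I_n -> 'M[C]_r) :
      \sum_i ([set j]%SET == [set i]%SET)%:R *: F i = F j.
    rewrite (bigD1 j) //= eqxx scale1r big1 ?addr0 // => i /negbTE ij.
    rewrite (_ : (_ == _) = false) ?scale0r //; apply/negP => /eqP/setP/(_ i).
    by rewrite !inE eqxx ij.
  under eq_fun do rewrite sum1.
  by under [RHS]eq_bigr do rewrite !ffunE; rewrite sum1.
have I0 j : (I == [set j]%SET) = false.
  by apply/negP => /eqP Ij; apply: noj; exists j.
rewrite [RHS]big1 => [|j _]; last by rewrite !ffunE I0 scale0r.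
under eq_fun do (rewrite big1; last by move=> j _; rewrite I0 scale0r).
by apply/matrixP => a b; rewrite !mxE; exact: cpartial_cst.
Qed.

(** The entrywise version of [is_cpartial]. *)
Definition is_mxpartial i (f : 'rV[R]_n -> 'M[C]_r) x (d : 'M[C]_r) :=
  forall a b, is_cpartial i (fun y => f y a b) x (d a b).

Lemma is_mxpartialE i f x d : is_mxpartial i f x d -> mxpartial i f x = d.
Proof.
by move=> fd; apply/matrixP => a b; rewrite mxE (is_cpartialE (fd a b)).
Qed.

Lemma is_mxpartialZ i (c : 'rV[R]_n -> C) f x dc df :
  is_cpartial i c x dc -> is_mxpartial i f x df ->
  is_mxpartial i (fun y => c y *: f y) x (c x *: df + dc *: f x).
Proof.
move=> hc hf a b; have := is_cpartialM hc (hf a b); rewrite !mxE.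
by have -> : (fun y => (c y *: f y) a b) = (fun y => c y * f y a b);
  first by apply/funext => y; rewrite mxE.
Qed.

Lemma is_mxpartial_sum i (J : Type) (s : seq J)
    (f : J -> 'rV[R]_n -> 'M[C]_r) d x :
  (forall j, is_mxpartial i (f j) x (d j)) ->
  is_mxpartial i (fun y => \sum_(j <- s) f j y) x (\sum_(j <- s) d j).
Proof.
move=> fd a b; rewrite summxE.
have -> : (fun y => (\sum_(j <- s) f j y) a b) =
    (fun y => \sum_(j <- s) f j y a b).
  by apply/funext => y; rewrite summxE.
by apply: is_cpartial_sum => j; exact: fd.
Qed.

Lemma form_sumE (J : Type) (s : seq J) (V : zmodType)
    (F : J -> Defs.form R n V) x :
  (\sum_(j <- s) F j) x = \sum_(j <- s) F j x.
Proof. by rewrite fct_sumE. Qed.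

End ExteriorDerivative.

Section TypeProjection.
Variables (R : realType) (m r : nat) (z : 'I_m -> 'rV[R]_(m + m) -> R[i]).
Local Notation C := R[i].

(** For [p = 0] the set of indices with the (1,0)-part selected is empty. *)
Lemma pqpart0E q (w : Defs.form R (m + m) 'M[C]_r) x :
  pqpart z 0 q w x = mproj (fun i => dcoord01 z i x : ext C (m + m)) q (w x).
Proof.
apply/ffunP => K; rewrite ffunE sum_ffunE [RHS]big_mkcond /=.
apply: eq_bigr => I _; rewrite (bigID (fun S => S == finset.set0)) /=.
rewrite [X in _ + X]big1 ?addr0; last first.
  by move=> S /andP[/and3P[_ ]]; rewrite cards_eq0 => -> _.
case: ifP => Iq; last first.
  rewrite big1 // => S /andP[/and3P[_ _]] + /eqP S0.
  by rewrite S0 finset.setD0 Iq.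
rewrite (big_pred1 finset.set0) => [|S /=]; last first.
  have [->|_] := eqVneq S finset.set0; last by rewrite andbF.
  by rewrite finset.sub0set cards0 finset.setD0 Iq.
rewrite !ffunE wedgesE big_map; congr ((_ : ext _ _) _ *: _).
by apply: eq_bigr => i _; rewrite inE.
Qed.

End TypeProjection.

(** * The potential and its complex frame *)

Section Potential.
Variables (R : realType) (m : nat).
Variables (B : set 'rV[R]_m) (phi : 'rV[R]_m -> R).
Hypothesis Bopen : forall x, B x -> \forall y \near x, B y.
Hypothesis phi_smooth : smooth_on B phi.
Hypothesis phi_posdef : forall x, B x -> posdef (hess phi x).

Lemma smooth_partialC (s : seq 'I_m) (i j : 'I_m) x : B x ->
  partial i (partial j (foldr (@partial R m) phi s)) x =
  partial j (partial i (foldr (@partial R m) phi s)) x.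
Proof.
move=> Bx; apply: schwarz.
- by apply: filterS (Bopen Bx) => y By; exact: (phi_smooth s).
- exact: (phi_smooth (j :: s)).
- exact: (phi_smooth (i :: s)).
Qed.

Lemma hess_sym x i j : B x -> hess phi x i j = hess phi x j i.
Proof. by move=> Bx; rewrite !mxE (smooth_partialC [::]). Qed.

Lemma derivable_hess x i j v : B x -> derivable (fun y => hess phi y i j) x v.
Proof.
move=> Bx; apply: diff_derivable; under eq_fun do rewrite mxE.
exact: (phi_smooth [:: i; j]).
Qed.

Lemma partial_hess x l i j : B x ->
  partial l (fun y => hess phi y i j) x = partial l (partial i (partial j phi)) x.
Proof.
move=> Bx; have -> // : (fun y => hess phi y i j) = partial i (partial j phi).
by apply/funext => y; rewrite mxE.
Qed.

(** The third derivatives of the potential are symmetric in the index of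
    differentiation and the second index of the Hessian. *)
Lemma partial_hess_sym x l i j : B x ->
  partial l (fun y => hess phi y i j) x = partial j (fun y => hess phi y i l) x.
Proof.
move=> Bx; rewrite (partial_hess l i j Bx) (partial_hess j i l Bx).
have sw k k' : \forall y \near x,
    partial k (partial k' phi) y = partial k' (partial k phi) y.
  by apply: filterS (Bopen Bx) => y By; exact: (smooth_partialC [::]).
transitivity (partial l (partial j (partial i phi)) x).
  exact: near_eq_derive (sw _ _).
apply: etrans (smooth_partialC [:: i] l j Bx) _.
exact: near_eq_derive (sw _ _).
Qed.

Lemma hess_unit x : B x -> hess phi x \in unitmx.
Proof.
move=> Bx; rewrite -row_free_unit -kermx_eq0; apply/negPn/negP => K0.
set v := nz_row (kermx (hess phi x)).
have v0 : v != 0 by rewrite nz_row_eq0.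
have := phi_posdef Bx v0.
suff -> : v *m hess phi x = 0 by rewrite mul0mx mxE ltxx.
by apply/sub_kermxP; exact: nz_row_sub.
Qed.

Lemma ihess_hess x : B x -> ihess phi x *m hess phi x = 1%:M.
Proof. by move=> Bx; rewrite mulVmx // hess_unit. Qed.

Lemma hess_ihess x : B x -> hess phi x *m ihess phi x = 1%:M.
Proof. by move=> Bx; rewrite mulmxV // hess_unit. Qed.

Lemma derivable_ihess x i j v : B x -> derivable (fun y => ihess phi y i j) x v.
Proof.
move=> Bx; apply: derivable_invmx => [a b|]; first exact: derivable_hess.
by apply: filterS (Bopen Bx) => y; exact: hess_unit.
Qed.

(** The derivative of [ihess phi *m hess phi = 1]. *)
Lemma partial_ihess x l k p : B x ->
  \sum_j partial l (fun y => ihess phi y k j) x * hess phi x j p =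
  - \sum_j ihess phi x k j * partial l (fun y => hess phi y j p) x.
Proof.
move=> Bx; apply/eqP; rewrite -addr_eq0 -big_split /=; apply/eqP.
transitivity (partial l (fun y => \sum_j ihess phi y k j * hess phi y j p) x).
  rewrite [RHS]/partial.
  have -> : (fun y => \sum_j ihess phi y k j * hess phi y j p) =
      \sum_j (fun y => ihess phi y k j) * (fun y => hess phi y j p).
    by apply/funext => y; rewrite fct_sumE.
  rewrite derive_sum => [|j]; last first.
    by apply: derivableM; [exact: derivable_ihess | exact: derivable_hess].
  apply: eq_bigr => j _.
  rewrite deriveM; [|exact: derivable_ihess|exact: derivable_hess].
  by rewrite addrC /GRing.scale /= /partial; congr (_ + _); rewrite mulrC.
transitivity (partial l (fun=> (1%:M : 'M[R]_m) k p) x);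
  last by rewrite /partial derive_cst.
apply: near_eq_derive; apply: filterS (Bopen Bx) => y By.
by rewrite -(ihess_hess By) [RHS]mxE.
Qed.

End Potential.

Section FrameChange.
Variables (C : fieldType) (V : lmodType C) (m : nat) (iota : C).
Variables (x y : 'I_m -> V) (H G : 'I_m -> 'I_m -> C).

Lemma inverse_lincomb k : (forall j l, \sum_t G j t * H t l = (j == l)%:R) ->
  \sum_j G k j *: (\sum_l H j l *: x l) = x k.
Proof.
move=> GH; under eq_bigr do rewrite scaler_sumr.
rewrite exchange_big /= (bigD1 k) //= [X in _ + X]big1 ?addr0 => [|l /negbTE lk].
  under eq_bigr do rewrite scalerA.
  by rewrite -scaler_suml GH eqxx scale1r.
under eq_bigr do rewrite scalerA.
by rewrite -scaler_suml GH eq_sym lk scale0r.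
Qed.

(** The (0,1)-part of [dx^k], for [H] and [G] the matrices of the Hessian and of
    its inverse. *)
Lemma frame_lower k : (forall j l, \sum_t G j t * H t l = (j == l)%:R) ->
  \sum_j 2^-1 *: (G k j *: (\sum_l H j l *: x l - iota *: y j)) =
  2^-1 *: (x k - iota *: \sum_j G k j *: y j).
Proof.
move=> GH; rewrite -scaler_sumr; congr (_ *: _).
under eq_bigr do rewrite scalerBr.
rewrite sumrB inverse_lincomb //; congr (_ - _).
by rewrite scaler_sumr; apply: eq_bigr => j _; rewrite !scalerA mulrC.
Qed.

End FrameChange.

(** The (0,1)-part of [dy~_k], in terms of those of the [dx^j]. *)
Lemma frame_raise (C : fieldType) (V : lmodType C) (m : nat) (iota : C)
    (x y : 'I_m -> V) (H G : 'I_m -> 'I_m -> C) (D : 'I_m -> V) k :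
    (forall j l, \sum_t H j t * G t l = (j == l)%:R) ->
    (forall k, D k = 2^-1 *: (x k - iota *: \sum_j G k j *: y j)) ->
  (iota / 2) *: (\sum_l H k l *: x l - iota *: y k) =
  iota *: \sum_j H k j *: D j.
Proof.
move=> HG DE; rewrite -scalerA; congr (_ *: _).
under [RHS]eq_bigr do rewrite DE scalerA mulrC -scalerA scalerBr.
rewrite -scaler_sumr sumrB; congr (_ *: (_ - _)).
rewrite -{1}(inverse_lincomb y k HG) scaler_sumr.
by apply: eq_bigr => j _; rewrite !scalerA mulrC.
Qed.

Section Frame.
Variables (R : realType) (m : nat).
Variables (B : set 'rV[R]_m) (phi : 'rV[R]_m -> R).
Hypothesis Bopen : forall x, B x -> \forall y \near x, B y.
Hypothesis phi_smooth : smooth_on B phi.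
Hypothesis phi_posdef : forall x, B x -> posdef (hess phi x).
Local Notation C := R[i].
Implicit Types p : 'rV[R]_(m + m).

Local Notation gx k := (ext_gen C (lshift m k) : ext C (m + m)).
Local Notation gy k := (ext_gen C (rshift m k) : ext C (m + m)).
Local Notation H p := (hess phi (lsubmx p)).
Local Notation G p := (ihess phi (lsubmx p)).

Lemma cpartial_zW_l j k p : cpartial (lshift m k) (zW phi j) p = (H p k j)%:C.
Proof.
rewrite /cpartial /= /xW mxE (partial_lsubmx_l k (partial j phi)) partial_rsubmx.
by rewrite eq_lrshift.
Qed.

Lemma cpartial_zW_r j k p : cpartial (rshift m k) (zW phi j) p = 'i * (k == j)%:R.
Proof.
rewrite /cpartial /= /xW (partial_lsubmx_r k (partial j phi)) partial_rsubmx.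
rewrite eq_rshift; case: (k == j); rewrite ?mulr1 ?mulr0 //.
Qed.

Lemma dzWE j p : dfun (zW phi j) p =
  \sum_k (H p k j)%:C *: gx k + 'i *: gy j :> ext C (m + m).
Proof.
rewrite dfunE big_split_ord /=; congr (_ + _).
  by apply: eq_bigr => k _; rewrite cpartial_zW_l.
rewrite (bigD1 j) //= big1 ?addr0 => [|k /negbTE kj].
  by rewrite cpartial_zW_r eqxx mulr1.
by rewrite cpartial_zW_r kj mulr0 scale0r.
Qed.

Lemma dxWE j p : dxW phi j p = \sum_k (H p k j)%:C *: gx k :> ext C (m + m).
Proof.
rewrite /dxW dfunE big_split_ord /= [X in _ + X]big1 ?addr0 => [|k _].
  apply: eq_bigr => k _; congr (_ *: _).
  rewrite /cpartial /= /xW mxE (partial_lsubmx_l k (partial j phi)).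
  by rewrite /partial derive_cst.
rewrite /cpartial /= /xW (partial_lsubmx_r k (partial j phi)).
by rewrite /partial derive_cst scale0r.
Qed.

Lemma dyWE j p : dyW j p = gy j :> ext C (m + m).
Proof.
have E i : cpartial i (fun q : 'rV[R]_(m + m) => (rsubmx q 0 j)%:C) p =
    (i == rshift m j)%:R.
  rewrite /cpartial /= partial_rsubmx /partial derive_cst.
  by case: eqP.
rewrite /dyW dfunE (bigD1 (rshift m j)) //= big1 ?addr0 => [|k /negbTE kj].
  by rewrite E eqxx scale1r.
by rewrite E kj scale0r.
Qed.

Local Notation D01 p i := (dcoord01 (zW phi) i p : ext C (m + m)).

(** The coframe [dz~_j], [conj dz~_j] has matrix [[H, i], [H, -i]] in
    [dx^k], [dy~_j]. *)
Lemma invmx_coframe p : B (lsubmx p) ->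
  invmx (coframe (zW phi) p) =
  block_mx ((2^-1 : C) *: map_mx (real_complex R) (G p))
           ((2^-1 : C) *: map_mx (real_complex R) (G p))
           (- ('i / 2))%:M ('i / 2)%:M.
Proof.
move=> Bp; set HC := map_mx (real_complex R) (H p).
have HG : HC *m map_mx (real_complex R) (G p) = 1%:M.
  by rewrite -map_mxM (hess_ihess phi_posdef) // map_mx1.
have -> : coframe (zW phi) p = block_mx HC 'i%:M HC (- 'i)%:M.
  rewrite /coframe /block_mx; congr col_mx.
    apply/matrixP => j i; rewrite [LHS]mxE; case: (split_ordP i) => k ->.
      by rewrite row_mxEl cpartial_zW_l [RHS]mxE (hess_sym Bopen).
    by rewrite row_mxEr cpartial_zW_r [RHS]mxE mulr_natr eq_sym.
  apply/matrixP => j i; rewrite mxE [X in (X^*)%C]mxE.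
  case: (split_ordP i) => k ->.
    by rewrite row_mxEl cpartial_zW_l [RHS]mxE (hess_sym Bopen) // conjc_real.
  rewrite row_mxEr cpartial_zW_r [RHS]mxE eq_sym mulr_natr.
  by case: (j == k); rewrite /= ?mulr1n ?mulr0n; simpc.
set M := block_mx HC _ _ _; set W := block_mx _ _ _ _.
suff MW : M *m W = 1%:M.
  have [Mu _] := mulmx1_unit MW.
  by rewrite -[LHS]mulmx1 -MW mulmxA (mulVmx Mu) mul1mx.
rewrite /M /W mulmx_block -!scalemxAr HG -!scalar_mxM !scale_scalar_mx mulr1.
have ii : ('i : C) * 'i = -1 by rewrite -expr2 sqr_i.
have half : 2^-1 + 2^-1 = 1 :> C by field.
have sc (a b : C) : a%:M + b%:M = (a + b)%:M :> 'M[C]_m by rewrite raddfD.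
have i2 : ('i : C) * ('i / 2) = - 2^-1 by rewrite mulrA ii mulN1r.
rewrite !sc mulrN mulrNN mulNr i2 opprK half addrN.
by rewrite raddf0 -scalar_mx_block.
Qed.

Lemma conj_dzWE j p : form_conj (dfun (zW phi j)) p =
  \sum_k (H p k j)%:C *: gx k - 'i *: gy j :> ext C (m + m).
Proof.
apply/ffunP => I; rewrite ffunE dzWE !ffunE !sum_ffunE rmorphD rmorph_sum /=.
congr (_ + _).
  apply: eq_bigr => k _; rewrite !ext_scaleE ffunE.
  by case: eqP => _; rewrite ?mulr1 ?mulr0 ?conjc_real ?conjc0.
have E (b : bool) : ('i * b%:R : C)^* = - ('i * b%:R).
  by case: b; rewrite ?mulr1 ?mulr0 ?conjc0 ?oppr0 //; simpc.
exact: E.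
Qed.

Lemma dcoord01_l k p : B (lsubmx p) ->
  D01 p (lshift m k) = (2^-1 : C) *: (gx k - 'i *: \sum_j (G p k j)%:C *: gy j).
Proof.
move=> Bp; rewrite /dcoord01 invmx_coframe //.
transitivity (\sum_(j < m) 2^-1 *: ((G p k j)%:C *:
    (\sum_l (H p l j)%:C *: gx l - 'i *: gy j))).
  apply: eq_bigr => j _.
  by rewrite block_mxEur conj_dzWE scalerA; congr (_ *: _); rewrite !mxE.
apply: (@frame_lower C (ext C (m + m)) m 'i (fun l => gx l) (fun j => gy j)
  (fun j l => (H p l j)%:C) (fun k j => (G p k j)%:C) k) => j l.
have /matrixP/(_ j l) := ihess_hess phi_posdef Bp.
rewrite [in X in X -> _]mxE [in X in X -> _]mxE => /(congr1 (real_complex R)).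
rewrite rmorph_sum rmorph_nat => <-; apply: eq_bigr => t _.
by rewrite rmorphM (hess_sym Bopen phi_smooth _ _ Bp).
Qed.

Lemma dcoord01_r k p : B (lsubmx p) ->
  D01 p (rshift m k) = 'i *: \sum_j (H p k j)%:C *: D01 p (lshift m j).
Proof.
move=> Bp.
have -> : D01 p (rshift m k) =
    ('i / 2) *: (\sum_l (H p l k)%:C *: gx l - 'i *: gy k).
  rewrite {1}/dcoord01 invmx_coframe // (bigD1 k) //= [X in _ + X]big1 ?addr0 =>
    [|j /negbTE jk].
    by rewrite block_mxEdr mxE eqxx mulr1n conj_dzWE.
  by rewrite block_mxEdr mxE eq_sym jk mulr0n scale0r.
under eq_bigr => l _ do rewrite (hess_sym Bopen phi_smooth l k Bp).
rewrite -(@frame_raise C (ext C (m + m)) m 'i (fun l => gx l) (fun j => gy j)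
  (fun j l => (H p j l)%:C) (fun k j => (G p k j)%:C)
  (fun l => D01 p (lshift m l))).
- by [].
- move=> j l; have /matrixP/(_ j l) := hess_ihess phi_posdef Bp.
  rewrite [in X in X -> _]mxE [in X in X -> _]mxE => /(congr1 (real_complex R)).
  rewrite rmorph_sum rmorph_nat => <-; apply: eq_bigr => t _.
  by rewrite rmorphM.
- by move=> l; exact: dcoord01_l.
Qed.

End Frame.

(** * The Dolbeault derivative of the difference of the connections *)

Section Core.
Variables (C : fieldType) (n r : nat).
Implicit Types (T : 'I_3 -> 'M[C]_r) (dT : 'I_3 -> 'I_3 -> 'M[C]_r).

(** The matrix whose trace is the coefficient of the Chern-Simons form
    [Tr (A dA + 2/3 A A A)], when [A] has coefficients [T k] and [dT l k] is the
    derivative of [T k] in the direction [l]. *)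
Definition cs_density T dT : 'M[C]_r :=
  \sum_p \sum_l \sum_k eps3 C p l k *:
    (T p *m dT l k + (2 / 3) *: (T p *m (T l *m T k))).

Lemma scale_tens k (u : ext C n) (g : 'M[C]_r) :
  (k *: (tens u g : {ffun _ -> 'M[C]_r})) = tens u (k *: g).
Proof. by apply/ffunP => I; rewrite !ffunE !scalerA mulrC. Qed.

Lemma cs_core (D : 'I_3 -> ext C n) T dT (b db : ext 'M[C]_r n) : anticomm D ->
    b = \sum_k tens (D k) (T k) ->
    db = \sum_l \sum_k tens (D l * D k) (dT l k) ->
  b * db +
    ((2 / 3 : C) *: (b * (b * b) : {ffun _ -> 'M[C]_r}) : ext 'M[C]_r n) =
  tens (\prod_(k < 3) D k) (cs_density T dT).
Proof.
move=> acD -> ->.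
have E (X : 'I_3 -> 'I_3 -> 'M[C]_r) : (\sum_k tens (D k) (T k)) *
    (\sum_l \sum_k tens (D l * D k) (X l k)) =
    tens (\prod_(k < 3) D k)
      (\sum_p \sum_l \sum_k eps3 C p l k *: (T p *m X l k)).
  rewrite mulr_suml tens_sumr; apply: eq_bigr => p _.
  rewrite mulr_sumr tens_sumr; apply: eq_bigr => l _.
  rewrite mulr_sumr tens_sumr; apply: eq_bigr => k _.
  by rewrite tens_mul anticomm3 // tensZ.
have -> : (\sum_k tens (D k) (T k)) * (\sum_k tens (D k) (T k)) =
    \sum_l \sum_k tens (D l * D k) (T l *m T k).
  rewrite mulr_suml; apply: eq_bigr => l _.
  by rewrite mulr_sumr; apply: eq_bigr => k _; rewrite tens_mul.
rewrite !E scale_tens -tensDr; congr tens; rewrite scaler_sumr -big_split.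
apply: eq_bigr => p _; rewrite scaler_sumr -big_split; apply: eq_bigr => l _.
rewrite scaler_sumr -big_split; apply: eq_bigr => k _.
by rewrite scalerDr !scalerA (mulrC (2 / 3)).
Qed.

Lemma tens_lincomb (J : finType) (u : ext C n) (v : J -> ext C n) (a b : J -> C)
    (X Y : 'M[C]_r) :
  \sum_j tens (u * v j) (a j *: X + b j *: Y) =
  tens (u * \sum_j a j *: v j) X + tens (u * \sum_j b j *: v j) Y.
Proof.
rewrite !mulr_sumr !tens_suml -big_split; apply: eq_bigr => j _.
by rewrite tensDr -!scalerAr !tensZ.
Qed.

(** Elements of degree 1 of the exterior algebra. *)
Definition is_one_form (u : ext C n) := exists c, u = \sum_i c i *: ext_gen C i.

Lemma is_one_form_gen i : is_one_form (ext_gen C i).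
Proof.
exists (fun j => (j == i)%:R); rewrite (bigD1 i) //= eqxx scale1r big1 ?addr0 //.
by move=> j /negbTE ->; rewrite scale0r.
Qed.

Lemma is_one_form0 : is_one_form 0.
Proof. by exists (fun=> 0); rewrite big1 // => i _; rewrite scale0r. Qed.

Lemma is_one_formD u v : is_one_form u -> is_one_form v -> is_one_form (u + v).
Proof.
move=> [c ->] [d ->]; exists (fun i => c i + d i); rewrite -big_split.
by apply: eq_bigr => i _; rewrite scalerDl.
Qed.

Lemma is_one_formZ k u : is_one_form u -> is_one_form (k *: u).
Proof.
move=> [c ->]; exists (fun i => k * c i); rewrite scaler_sumr.
by apply: eq_bigr => i _; rewrite scalerA.
Qed.

Lemma is_one_form_sum (J : finType) (u : J -> ext C n) :
  (forall j, is_one_form (u j)) -> is_one_form (\sum_j u j).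
Proof.
move=> lu; apply: big_ind => //; first exact: is_one_form0.
exact: is_one_formD.
Qed.

Lemma one_form_anticomm u v :
  is_one_form u -> is_one_form v -> u * v = - (v * u).
Proof.
move=> [c ->] [d ->].
apply: (@anticomm_lincomb C (ext C n) unit _ _ (fun=> c) (fun=> d) tt tt).
by case: (anticomm_gen C n).
Qed.

End Core.

Section ContractSym.
Variables (C : fieldType) (n m : nat).
Hypothesis two_unit : (2 : C) \is a GRing.unit.

Lemma contract_sym (D : 'I_m -> ext C n) (s : 'I_m -> 'I_m -> C) :
  (forall l p, D l * D p = - (D p * D l)) -> (forall l p, s l p = s p l) ->
  \sum_l \sum_p s l p *: (D l * D p) = 0.
Proof.
move=> acD ss; set S := \sum_l _.
have SN : S = - S.
  rewrite {2}/S exchange_big /= -sumrN; apply: eq_bigr => l _.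
  by rewrite -sumrN; apply: eq_bigr => p _; rewrite ss acD scalerN.
have /eqP : S + S = 0 by rewrite {2}SN addrN.
rewrite -mulr2n -scaler_nat => /eqP h.
by rewrite -[LHS]scale1r -(mulVr two_unit) -scalerA h scaler0.
Qed.

End ContractSym.

(** In the application, [D k] and [Dy j] are the (0,1)-parts of [dx^k] and
    [dy~_j], [G] and [H] are the matrices [(phi^{jk})] and [(phi_{jk})], and
    [dG l] is the derivative of [G] in the direction [l].  The terms with [Y k]
    are those where the derivative falls on the frame; they vanish by the
    symmetry hypothesis [dGH_sym]. *)
Section FrameContraction.
Variables (C : fieldType) (n m r : nat) (iota : C).
Variables (D Dy : 'I_m -> ext C n) (G H : 'I_m -> 'I_m -> C).
Variables (dG : 'I_m -> 'I_m -> 'I_m -> C).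
Variables (X : 'I_m -> 'I_m -> 'M[C]_r) (Y : 'I_m -> 'M[C]_r).
Hypothesis two_unit : (2 : C) \is a GRing.unit.
Hypothesis iota2 : iota * iota = -1.
Hypothesis DyE : forall j, Dy j = iota *: \sum_k H j k *: D k.
Hypothesis GH : forall k p, \sum_j G k j * H j p = (k == p)%:R.
Hypothesis dGH_sym : forall k l t,
  \sum_j dG l k j * H j t = \sum_j dG t k j * H j l.
Hypothesis acD : anticomm D.

Lemma sum_Dy (c : 'I_m -> C) :
  \sum_j (- (iota / 2) * c j) *: Dy j =
  \sum_k (2^-1 * \sum_j c j * H j k) *: D k.
Proof.
under eq_bigr do rewrite DyE !scaler_sumr.
rewrite exchange_big; apply: eq_bigr => k _ /=.
rewrite mulr_sumr scaler_suml; apply: eq_bigr => j _ /=.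
rewrite !scalerA; congr (_ *: _).
transitivity (- (iota * iota) * (2^-1 * (c j * H j k))); first by ring.
by rewrite iota2 opprK mul1r.
Qed.

Lemma frame_contraction :
  \sum_l (\sum_k tens (D l * D k) (2^-1 *: X l k) +
    \sum_j \sum_k tens (D l * Dy j)
      ((- (iota / 2) * G k j) *: X l k + (- (iota / 2) * dG l k j) *: Y k)) =
  \sum_l \sum_k tens (D l * D k) (X l k).
Proof.
pose s k l t : C := 2^-1 * \sum_j dG l k j * H j t.
transitivity (\sum_l \sum_k (tens (D l * D k) (X l k) +
    tens (\sum_t s k l t *: (D l * D t)) (Y k))).
  apply: eq_bigr => l _; rewrite [X in _ + X]exchange_big -big_split.
  apply: eq_bigr => k _ /=; rewrite tens_lincomb !sum_Dy addrA; congr (_ + _).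
    have -> : \sum_t (2^-1 * \sum_j G k j * H j t) *: D t = 2^-1 *: D k.
      rewrite (bigD1 k) //= [X in _ + X]big1 ?addr0 => [|t /negbTE tk].
        by rewrite GH eqxx mulr1.
      by rewrite GH eq_sym tk mulr0 scale0r.
    rewrite -scalerAr tensZ -tensDr -scalerDl.
    by rewrite -mulr2n -[2^-1 *+ 2]mulr_natl mulrV // scale1r.
  by rewrite mulr_sumr; congr tens; apply: eq_bigr => t _; rewrite scalerAr.
under eq_bigr do rewrite big_split /=.
rewrite big_split /= [X in _ + X]exchange_big [X in _ + X]big1 ?addr0 // => k _.
rewrite /= -tens_suml contract_sym ?tens0l //.
  by move=> l t; case: acD.
by move=> l t; rewrite /s dGH_sym.
Qed.

End FrameContraction.

Section LsubmxPartial.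
Variables (R : realType) (m r : nat).
Local Notation C := R[i].
Implicit Types p : 'rV[R]_(m + m).

Lemma is_cpartial_lsubmx_l k (g : 'rV[R]_m -> C) p d : is_cpartial k g (lsubmx p) d ->
  is_cpartial (lshift m k) (fun q => g (lsubmx q)) p d.
Proof.
move=> [[dr er] [di ei]]; split; split.
- by rewrite (derivable_lsubmx _ (fun y => complex.Re (g y))) lsubmx_delta_l.
- by rewrite -er; exact: (partial_lsubmx_l k (fun y => complex.Re (g y))).
- by rewrite (derivable_lsubmx _ (fun y => complex.Im (g y))) lsubmx_delta_l.
- by rewrite -ei; exact: (partial_lsubmx_l k (fun y => complex.Im (g y))).
Qed.

Lemma cpartial_lsubmx_r k (g : 'rV[R]_m -> C) p :
  cpartial (rshift m k) (fun q => g (lsubmx q)) p = 0.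
Proof.
rewrite /cpartial (partial_lsubmx_r k (fun y => complex.Re (g y))).
by rewrite (partial_lsubmx_r k (fun y => complex.Im (g y))).
Qed.

Lemma is_mxpartial_lsubmx_l k (g : 'rV[R]_m -> 'M[C]_r) p d :
  is_mxpartial k g (lsubmx p) d ->
  is_mxpartial (lshift m k) (fun q => g (lsubmx q)) p d.
Proof. by move=> gd a b; exact: (is_cpartial_lsubmx_l (gd a b)). Qed.

Lemma mxpartial_lsubmx_r k (g : 'rV[R]_m -> 'M[C]_r) p :
  mxpartial (rshift m k) (fun q => g (lsubmx q)) p = 0.
Proof.
apply/matrixP => a b; rewrite !mxE.
exact: (cpartial_lsubmx_r k (fun y => g y a b)).
Qed.

Lemma smooth_is_mxpartial (B : set 'rV[R]_m) (g : 'rV[R]_m -> 'M[C]_r) l x :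
  smooth_mx_on B g -> B x -> is_mxpartial l g x (mxpartial l g x).
Proof.
move=> sg Bx a b; have [/(_ [::] _ Bx) dr /(_ [::] _ Bx) di] := sg a b.
by rewrite mxE; split; apply: derivableP; exact: diff_derivable.
Qed.

End LsubmxPartial.

Lemma complex_two_unit (R : realType) : (2 : R[i]) \is a GRing.unit.
Proof. by rewrite unitfE pnatr_eq0. Qed.

Section Connection.
Variables (R : realType) (m r : nat).
Variables (B : set 'rV[R]_m) (phi f : 'rV[R]_m -> R).
Variable e : 'I_m -> 'rV[R]_m -> 'M[R[i]]_r.
Hypothesis Bopen : forall x, B x -> \forall y \near x, B y.
Hypothesis Bopen2 : forall p : 'rV[R]_(m + m),
  B (lsubmx p) -> \forall q \near p, B (lsubmx q).
Hypothesis phi_smooth : smooth_on B phi.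
Hypothesis phi_posdef : forall x, B x -> posdef (hess phi x).
Hypothesis e_smooth : forall k, smooth_mx_on B (e k).
Local Notation C := R[i].
Implicit Types p q : 'rV[R]_(m + m).

Local Notation gx k := (ext_gen C (lshift m k) : ext C (m + m)).
Local Notation gy k := (ext_gen C (rshift m k) : ext C (m + m)).
Local Notation H p := (hess phi (lsubmx p)).
Local Notation G p := (ihess phi (lsubmx p)).
Local Notation D01 p i := (dcoord01 (zW phi) i p : ext C (m + m)).

Lemma connW0E q : exists beta : 'I_m -> C,
  connW0 phi f q = \sum_j tens (gy j) (beta j)%:M :> ext 'M[C]_r (m + m).
Proof.
exists (fun j =>
  'i * \sum_k (ihess phi (lsubmx q) j k * partial k f (lsubmx q))%:C).
rewrite -[LHS]/('i *: (\sum_(j < m) _) q) form_sumE scaler_sumr.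
apply: eq_bigr => j _; rewrite form_sumE.
under eq_bigr do rewrite form_mxE dyWE.
by rewrite -tens_sumr scale_tens -raddf_sum /= scale_scalar_mx.
Qed.

Lemma connW_sub q : B (lsubmx q) ->
  (connW phi f e - connW0 phi f) q =
  \sum_k tens (gx k) ('i *: e k (lsubmx q)) :> ext 'M[C]_r (m + m).
Proof.
move=> Bq; rewrite -[LHS]/('i *: (\sum_(j < m) _) q - 'i *: (\sum_(j < m) _) q).
rewrite -scalerBr !form_sumE -sumrB.
transitivity ('i *: (\sum_(j < m) \sum_(k < m)
    tens (dxW phi j q : ext C (m + m)) ((G q j k)%:C *: e k (lsubmx q)))
   : ext 'M[C]_r (m + m)).
  congr (_ *: _); apply: eq_bigr => j _; rewrite !form_sumE -sumrB.
  by apply: eq_bigr => k _; rewrite -[LHS]/(_ + _ - _) addrAC subrr add0r.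
rewrite exchange_big /= scaler_sumr; apply: eq_bigr => k _.
under eq_bigr do rewrite -tensZ.
rewrite -tens_suml scale_tens; congr tens.
under eq_bigr do rewrite dxWE scaler_sumr.
rewrite exchange_big /= (bigD1 k) //= [X in _ + X]big1 ?addr0 => [|l /negbTE lk].
  under eq_bigr do rewrite scalerA mulrC -rmorphM.
  rewrite -scaler_suml -rmorph_sum /=.
  have /matrixP/(_ k k) := hess_ihess phi_posdef Bq; rewrite mxE => ->.
  by rewrite mxE eqxx scale1r.
under eq_bigr do rewrite scalerA mulrC -rmorphM.
rewrite -scaler_suml -rmorph_sum /=.
have /matrixP/(_ l k) := hess_ihess phi_posdef Bq; rewrite mxE => ->.
by rewrite mxE lk scale0r.
Qed.

(** The (0,1)-form [b = (A - A_0)^{0,1}] on [W]. *)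
Definition dbarpart := pqpart (zW phi) 0 1 (connW phi f e - connW0 phi f).

Lemma dbarpartE q : B (lsubmx q) -> dbarpart q =
  \sum_k tens (D01 q (lshift m k)) ('i *: e k (lsubmx q))
  :> ext 'M[C]_r (m + m).
Proof.
move=> Bq; rewrite /dbarpart pqpart0E connW_sub // mproj_sum.
by apply: eq_bigr => k _; rewrite mproj_tens sproj1.
Qed.

Lemma dcoord01_one_form p i : B (lsubmx p) -> is_one_form (D01 p i).
Proof.
have l1 k : B (lsubmx p) -> is_one_form (D01 p (lshift m k)).
  move=> Bp; rewrite (dcoord01_l Bopen) //; apply: is_one_formZ.
  apply: is_one_formD.
    exact: is_one_form_gen.
  rewrite -scaleN1r; do 2!apply: is_one_formZ; apply: is_one_form_sum => j.
  by apply: is_one_formZ; exact: is_one_form_gen.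
move=> Bp; case: (split_ordP i) => k ->; first exact: l1.
rewrite (dcoord01_r Bopen) //; apply: is_one_formZ; apply: is_one_form_sum => j.
by apply: is_one_formZ; exact: l1.
Qed.

Lemma dcoord01_anticomm p : B (lsubmx p) -> anticomm (fun i => D01 p i).
Proof.
move=> Bp; apply: (anticommP (complex_two_unit R)) => i j.
by apply: one_form_anticomm; exact: dcoord01_one_form.
Qed.

(** The coefficient of [dx^k] in the connection form on [C], pulled back to
    [W]. *)
Definition conn_coef k q : 'M[C]_r := 'i *: e k (lsubmx q).

(** The coefficients of [dbarpart] in the real frame [dx^k], [dy~_j]. *)
Definition dbar_coef (i : 'I_(m + m)) q : 'M[C]_r :=
  match fintype.split i with
  | inl k => 2^-1 *: conn_coef k q
  | inr j => \sum_k (- ('i / 2) * (G q k j)%:C) *: conn_coef k q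
  end.

Lemma dbar_coef_l k q : dbar_coef (lshift m k) q = 2^-1 *: conn_coef k q.
Proof. by rewrite /dbar_coef (unsplitK (inl k)). Qed.

Lemma dbar_coef_r j q : dbar_coef (rshift m j) q =
  \sum_k (- ('i / 2) * (G q k j)%:C) *: conn_coef k q.
Proof. by rewrite /dbar_coef (unsplitK (inr j)). Qed.

Lemma dbarpart_coefE q : B (lsubmx q) -> dbarpart q =
  \sum_i tens (ext_gen C i) (dbar_coef i q) :> ext 'M[C]_r (m + m).
Proof.
move=> Bq; rewrite dbarpartE // big_split_ord /=.
under [X in _ = X + _]eq_bigr do rewrite dbar_coef_l -tensZ.
under [X in _ = _ + X]eq_bigr do rewrite dbar_coef_r tens_sumr.
rewrite [X in _ = _ + X]exchange_big -big_split; apply: eq_bigr => k _ /=.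
rewrite (dcoord01_l Bopen) // scalerBr tensDl; congr (_ + _).
rewrite scalerA -scaleNr scaler_sumr tens_suml; apply: eq_bigr => j _.
by rewrite scalerA tensZ (mulrC 2^-1).
Qed.

Lemma is_mxpartial_conn_coef l k p : B (lsubmx p) ->
  is_mxpartial (lshift m l) (conn_coef k) p
    ('i *: mxpartial l (e k) (lsubmx p)).
Proof.
move=> Bp.
have := is_mxpartialZ (is_cpartial_cst (lshift m l) ('i : C) p)
  (is_mxpartial_lsubmx_l (smooth_is_mxpartial l (@e_smooth k) Bp)).
by rewrite scale0r addr0.
Qed.

Lemma mxpartial_coef_l l k p : B (lsubmx p) ->
  mxpartial (lshift m l) (dbar_coef (lshift m k)) p =
  2^-1 *: ('i *: mxpartial l (e k) (lsubmx p)).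
Proof.
move=> Bp; apply: is_mxpartialE.
have -> : dbar_coef (lshift m k) = fun q => 2^-1 *: conn_coef k q.
  by apply/funext => q; exact: dbar_coef_l.
have := is_mxpartialZ (is_cpartial_cst (lshift m l) (2^-1 : C) p)
  (is_mxpartial_conn_coef l k Bp).
by rewrite scale0r addr0.
Qed.

Lemma mxpartial_coef_r l j p : B (lsubmx p) ->
  mxpartial (lshift m l) (dbar_coef (rshift m j)) p =
  \sum_k ((- ('i / 2) * (G p k j)%:C) *: ('i *: mxpartial l (e k) (lsubmx p)) +
   (- ('i / 2) * (partial l (fun y => ihess phi y k j) (lsubmx p))%:C)
     *: conn_coef k p).
Proof.
move=> Bp; apply: is_mxpartialE.
have -> : dbar_coef (rshift m j) =
    fun q => \sum_k (- ('i / 2) * (G q k j)%:C) *: conn_coef k q.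
  by apply/funext => q; exact: dbar_coef_r.
apply: is_mxpartial_sum => k.
apply: is_mxpartialZ (is_mxpartial_conn_coef l k Bp).
have dG : is_cpartial l (fun y => (ihess phi y k j)%:C) (lsubmx p)
    (partial l (fun y => ihess phi y k j) (lsubmx p))%:C.
  by apply: is_cpartial_real; exact: (derivable_ihess Bopen).
have := is_cpartialM (is_cpartial_cst (lshift m l) (- ('i / 2) : C) p)
  (is_cpartial_lsubmx_l dG).
by rewrite mul0r addr0.
Qed.

Lemma mxpartial_coef_y l i p : mxpartial (rshift m l) (dbar_coef i) p = 0.
Proof.
pose g (y : 'rV[R]_m) : 'M[C]_r := match fintype.split i with
  | inl k => 2^-1 *: ('i *: e k y)
  | inr j => \sum_k (- ('i / 2) * (ihess phi y k j)%:C) *: ('i *: e k y) end.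
exact: (mxpartial_lsubmx_r l g).
Qed.

Lemma mproj_mxextd_dbarpart p : B (lsubmx p) ->
  mproj (fun i => D01 p i) 2 (mxextd dbarpart p) =
  \sum_l \sum_k tens (D01 p (lshift m l) * D01 p (lshift m k))
                     ('i *: mxpartial l (e k) (lsubmx p)).
Proof.
move=> Bp; have acD := dcoord01_anticomm Bp.
rewrite (@mxextd_one_form _ _ _ _ dbar_coef); last first.
  by apply: filterS (Bopen2 Bp) => q Bq; exact: dbarpart_coefE.
(* The coefficients do not depend on the torus coordinates. *)
rewrite mproj_sum big_split_ord /= [X in _ + X]big1 ?addr0 => [|l _]; last first.
  by rewrite mproj_sum big1 // => i _; rewrite mproj_tens mxpartial_coef_y tens0r.
rewrite -(@frame_contraction C _ m r 'i (fun k => D01 p (lshift m k))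
  (fun j => D01 p (rshift m j)) (fun k j => (G p k j)%:C) (fun j k => (H p j k)%:C)
  (fun l k j => (partial l (fun y => ihess phi y k j) (lsubmx p))%:C)
  (fun l k => 'i *: mxpartial l (e k) (lsubmx p))
  (fun k => conn_coef k p)); first last.
- by split=> [i|i j]; case: acD.
- move=> k l t; under eq_bigr do rewrite -rmorphM.
  under [RHS]eq_bigr do rewrite -rmorphM.
  rewrite -!rmorph_sum; congr (_%:C).
  rewrite (partial_ihess Bopen phi_smooth phi_posdef l k t Bp).
  rewrite (partial_ihess Bopen phi_smooth phi_posdef t k l Bp).
  congr (- _); apply: eq_bigr => j _; congr (_ * _).
  exact: (partial_hess_sym Bopen phi_smooth).
- move=> k q; under eq_bigr do rewrite -rmorphM.
  rewrite -rmorph_sum; have /matrixP/(_ k q) := ihess_hess phi_posdef Bp.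
  by rewrite mxE => ->; rewrite mxE rmorph_nat.
- by move=> j; exact: (dcoord01_r Bopen).
- by rewrite -expr2 sqr_i.
- exact: complex_two_unit.
apply: eq_bigr => l _; rewrite mproj_sum big_split_ord; congr (_ + _).
  apply: eq_bigr => k _; rewrite mproj_tens sproj2; last exact: acD.
  by congr tens; exact: mxpartial_coef_l.
apply: eq_bigr => j _; rewrite mproj_tens sproj2; last exact: acD.
by rewrite mxpartial_coef_r // tens_sumr.
Qed.

(** The connection form [A_0] only contributes its anticommutator with
    [dbarpart], which vanishes since [A_0] is scalar. *)
Lemma dbar_dbarpart p : B (lsubmx p) ->
  dbar (zW phi) 0 1 (connW0 phi f) dbarpart p =
  \sum_l \sum_k tens (D01 p (lshift m l) * D01 p (lshift m k))
                     ('i *: mxpartial l (e k) (lsubmx p))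
  :> ext 'M[C]_r (m + m).
Proof.
move=> Bp; rewrite /dbar pqpart0E -mproj_mxextd_dbarpart //; congr mproj.
have [beta A0E] := connW0E p.
set sg := (fun x =>
  [ffun I : {set 'I_(m + m)} => (-1) ^+ #|I| * dbarpart x I]).
have sgE : sg p = - \sum_k tens (D01 p (lshift m k)) (conn_coef k p)
    :> ext 'M[C]_r (m + m).
  rewrite -dbarpartE // /sg dbarpart_coefE //; apply/ffunP => I.
  rewrite !ffunE !sum_ffunE mulr_sumr -sumrN; apply: eq_bigr => i _.
  rewrite !ffunE; case: eqP => [->|_]; last by rewrite scale0r mulr0 oppr0.
  by rewrite cards1 expr1 mulN1r.
rewrite -[LHS]/(mxextd dbarpart p
  + (connW0 phi f p : ext 'M[C]_r (m + m)) * dbarpart p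
  - (sg p : ext 'M[C]_r (m + m)) * connW0 phi f p).
rewrite sgE mulNr opprK -addrA -[RHS]addr0; congr (_ + _).
rewrite dbarpartE // A0E mulr_suml mulr_sumr -big_split big1 // => j _ /=.
rewrite mulr_sumr mulr_suml -big_split big1 // => k _ /=.
rewrite !tens_mul mul_scalar_mx mul_mx_scalar -tensDl.
rewrite (one_form_anticomm (is_one_form_gen _ _) (dcoord01_one_form _ Bp)).
by rewrite addNr tens0l.
Qed.

End Connection.

(** * The pointwise identity *)

Section PointwiseCS.
Variables (R : realType) (r : nat).
Variables (B : set 'rV[R]_3) (phi f : 'rV[R]_3 -> R).
Variable e : 'I_3 -> 'rV[R]_3 -> 'M[R[i]]_r.
Hypothesis Bopen : forall x, B x -> \forall y \near x, B y.
Hypothesis Bopen2 : forall p : 'rV[R]_(3 + 3),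
  B (lsubmx p) -> \forall q \near p, B (lsubmx q).
Hypothesis phi_smooth : smooth_on B phi.
Hypothesis phi_posdef : forall x, B x -> posdef (hess phi x).
Hypothesis e_smooth : forall k, smooth_mx_on B (e k).
Local Notation C := R[i].

Local Notation density x := (cs_density (fun k => 'i *: e k x)
  (fun l k => 'i *: mxpartial l (e k) x)).

Lemma connCE x :
  connC e x = \sum_k tens (ext_gen C k) ('i *: e k x) :> ext 'M[C]_r 3.
Proof.
rewrite -[LHS]/('i *: (\sum_(j < 3) _) x) form_sumE scaler_sumr.
by apply: eq_bigr => k _; rewrite form_mxE scale_tens.
Qed.

Lemma CS_top x : B x -> top_coef (CS_form (connC e)) x = \tr (density x).
Proof.
move=> Bx; rewrite /top_coef /CS_form ffunE.
set w := (_ + _ : Defs.form R 3 'M[C]_r).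
have dA : mxextd (connC e) x = \sum_l \sum_k
    tens (ext_gen C l * ext_gen C k) ('i *: mxpartial l (e k) x).
  rewrite (@mxextd_one_form _ _ _ _ (fun k y => 'i *: e k y)); last first.
    by apply: (filterE (F := nbhs x)) => y; exact: connCE.
  apply: eq_bigr => l _; apply: eq_bigr => k _; congr tens.
  apply: is_mxpartialE.
  have := is_mxpartialZ (is_cpartial_cst l ('i : C) x)
    (smooth_is_mxpartial l (@e_smooth k) Bx).
  by rewrite scale0r addr0.
have -> : w x = tens (\prod_(k < 3) ext_gen C k) (density x).
  exact: (cs_core (@anticomm_gen C 3) (connCE x) dA).
by rewrite tr_tens ext_gen_top ffunE eqxx mulr1.
Qed.

(** The value [i] is the pointwise ratio of the two Chern-Simons integrands. *)
Lemma OmegaW_top p : B (lsubmx p) ->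
  ((OmegaW phi p : ext C (3 + 3)) *
   \prod_(k < 3) (dcoord01 (zW phi) (lshift 3 k) p : ext C (3 + 3)))
    [set: 'I_(3 + 3)]%SET = 'i.
Proof.
move=> Bp; have [sqg acg] := @anticomm_gen C (3 + 3).
have -> : (OmegaW phi p : ext C (3 + 3)) =
    \prod_(j < 3) (dfun (zW phi j) p : ext C (3 + 3)).
  by rewrite /OmegaW /volform wedgesE big_map enumT [index_enum _]unlock.
rewrite (@holomorphic_antiholomorphic_top C (complex_two_unit R) _ 'i
  (fun k => ext_gen C (lshift 3 k)) (fun k => ext_gen C (rshift 3 k))
  (map_mx (real_complex R) (hess phi (lsubmx p)))
  (map_mx (real_complex R) (ihess phi (lsubmx p)))).
- have -> : (\prod_(k < 3) ext_gen C (lshift 3 k)) *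
      (\prod_(k < 3) ext_gen C (rshift 3 k)) =
      \prod_(i < 3 + 3) ext_gen C i by rewrite big_split_ord.
  by rewrite ext_scaleE ext_gen_top ffunE eqxx mulr1.
- by rewrite -expr2 sqr_i.
- by rewrite -map_mxM (hess_ihess phi_posdef) // map_mx1.
- by split=> [i|i j].
- by split=> [i|i j].
- by move=> i j.
- move=> j; rewrite dzWE; congr (_ + _); apply: eq_bigr => k _.
  rewrite (hess_sym Bopen phi_smooth _ _ Bp); congr (_ *: _).
  by rewrite [RHS]mxE.
move=> k; apply: (etrans (dcoord01_l Bopen phi_smooth phi_posdef k Bp)).
have -> : \sum_j (ihess phi (lsubmx p) k j)%:C *:
      (ext_gen C (rshift 3 j) : ext C (3 + 3)) =
    \sum_j map_mx (real_complex R) (ihess phi (lsubmx p)) k j *: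
      ext_gen C (rshift 3 j).
  by apply: eq_bigr => j _; rewrite mxE.
by [].
Qed.

Lemma CShol_top p : B (lsubmx p) ->
  top_coef (CShol_form phi (connW phi f e) (connW0 phi f)) p =
  'i * top_coef (CS_form (connC e)) (lsubmx p).
Proof.
move=> Bp; rewrite CS_top // /top_coef /CShol_form.
set b := pqpart _ _ _ _; set w0 := (_ + _ : Defs.form R (3 + 3) 'M[C]_r).
have acD : anticomm (fun k => dcoord01 (zW phi) (lshift 3 k) p : ext C (3 + 3)).
  have [sq ac] := dcoord01_anticomm Bopen phi_smooth phi_posdef Bp.
  by split=> [i|i j]; [exact: sq | exact: ac].
have w0E : w0 p = tens (\prod_(k < 3) (dcoord01 (zW phi) (lshift 3 k) p : ext C (3 + 3)))
    (density (lsubmx p)).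
  exact: (cs_core acD (dbarpartE f e phi_posdef Bp)
    (dbar_dbarpart f Bopen Bopen2 phi_smooth phi_posdef e_smooth Bp)).
have wE : form_tr w0 p = \tr (density (lsubmx p)) *:
    \prod_(k < 3) (dcoord01 (zW phi) (lshift 3 k) p : ext C (3 + 3)) :> ext C (3 + 3).
  by apply/ffunP => I; rewrite ext_scaleE ffunE w0E tr_tens.
rewrite wedgeE wE -scalerAr ext_scaleE mulrC; congr (_ * _).
exact: OmegaW_top.
Qed.

End PointwiseCS.

(** * The volume of the dual torus *)

Section Preserving.
Context d (T : measurableType d) (R : realType).
Variable mu : {measure set T -> \bar R}.

(** Measurable self-maps [s] whose image measure of [mu] is [mu]. *)
Definition measure_preserving (s : T -> T) :=
  measurable_fun setT s /\ forall A, measurable A -> mu (s @^-1` A) = mu A.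

Section Partition.
Variables (I : countType) (g : I -> set T).
Hypothesis mg : forall i, measurable (g i).
Hypothesis g_cover : forall y, exists i, g i y.
Hypothesis g_uniq : forall y i j, g i y -> g j y -> i = j.

Local Notation gn n := (if pickle_inv n is Some i then g i else set0).

(** A partition indexed by a countable type is enumerated by [pickle_inv],
    with empty sets at the indices that code nothing. *)
Lemma measure_partition A : measurable A ->
  mu A = (\sum_(n <oo) mu (A `&` (if pickle_inv n is Some i then g i else set0)))%E.
Proof.
move=> mA; transitivity (mu (\bigcup_n (A `&` gn n))).
  congr (mu _); rewrite -setI_bigcupr; apply/esym/setIidPl => y _.
  by have [i gi] := g_cover y; exists (pickle i) => //; rewrite pickleK_inv.
rewrite measure_bigcup //.
- by apply: eq_eseriesl => n; rewrite in_setT.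
- move=> n _; apply: measurableI => //.
  by case: (pickle_inv n).
- apply/trivIsetP => n n' _ _ nn'; rewrite -subset0 => y [[_ +] [_]].
  have := @pickle_invK I n; have := @pickle_invK I n'.
  case: (pickle_inv n) => [i|//]; case: (pickle_inv n') => [j|//] /= jn' in_ gi gj.
  by move: nn'; rewrite -jn' -in_ (g_uniq gi gj) eqxx.
Qed.

End Partition.

(** [F1] and [F2] are fundamental domains of the same countable family of
    transformations.  Cut [F1] into the pieces which [s' i] maps into [F2];
    applying the inverse of [s' i] to each piece gives a partition of [F2]. *)
Lemma fundamental_domain_measure (I : countType) (s s' : I -> T -> T)
    (F1 F2 : set T) : measurable F1 -> measurable F2 ->
    (forall i, measure_preserving (s i)) -> (forall i, measure_preserving (s' i)) ->
    (forall i y, s' i (s i y) = y) ->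
    (forall y, exists i, F1 (s i y)) ->
    (forall y i j, F1 (s i y) -> F1 (s j y) -> i = j) ->
    (forall y, exists i, F2 (s' i y)) ->
    (forall y i j, F2 (s' i y) -> F2 (s' j y) -> i = j) ->
  mu F1 = mu F2.
Proof.
move=> mF1 mF2 ps ps' s'K c1 u1 c2 u2.
have mpre F h : measurable F -> measure_preserving h -> measurable (h @^-1` F).
  by move=> mF [mh _]; rewrite -[X in measurable X]setTI; exact: mh.
rewrite (measure_partition (g := fun i => s' i @^-1` F2) _ c2 u2 mF1) //; last first.
  by move=> i; exact: mpre.
rewrite (measure_partition (g := fun i => s i @^-1` F1) _ c1 u1 mF2); last first.
  by move=> i; exact: mpre.
apply: eq_eseriesr => n _; case: (pickle_inv n) => [i|]; last by rewrite !setI0.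
have [_ <-] := ps i; last by apply: measurableI => //; exact: mpre.
congr (mu _); rewrite preimage_setI setIC; congr (_ `&` _).
by apply/seteqP; split=> y /=; rewrite s'K.
Qed.

Lemma fundamental_domain_null (I : countType) (s : I -> T -> T) (F : set T) :
    measurable F -> (forall i, measure_preserving (s i)) ->
    (forall y, exists i, F (s i y)) ->
    (forall y i j, F (s i y) -> F (s j y) -> i = j) ->
  mu F = 0%E -> mu setT = 0%E.
Proof.
move=> mF ps c u F0.
have mg i : measurable (s i @^-1` F).
  by have [ms _] := ps i; rewrite -[X in measurable X]setTI; exact: ms.
rewrite (measure_partition mg c u measurableT) eseries0 // => n _ _.
case: (pickle_inv n) => [i|]; last by rewrite setI0 measure0.
by rewrite setTI; have [_ ->] := ps i.
Qed.

End Preserving.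

Section ProductPreserving.
Context d1 d2 (T1 : measurableType d1) (T2 : measurableType d2) (R : realType).
Variable m1 : {sigma_finite_measure set T1 -> \bar R}.
Variable m2 : {sigma_finite_measure set T2 -> \bar R}.

Lemma prod_measure_preserving s1 s2 :
  measure_preserving m1 s1 -> measure_preserving m2 s2 ->
  measure_preserving (prod_measure m1 m2) (fun p => (s1 p.1, s2 p.2)).
Proof.
move=> [ms1 ps1] [ms2 ps2].
have ms : measurable_fun setT (fun p : T1 * T2 => (s1 p.1, s2 p.2)).
  apply: measurable_fun_pair.
    exact: (measurableT_comp ms1 measurable_fst).
  exact: (measurableT_comp ms2 measurable_snd).
split=> // A mA.
pose h : T1 * T2 -> T1 * T2 := fun p => (s1 p.1, s2 p.2).
have mh : measurable_fun setT h by [].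
rewrite -[LHS]/(pushforward (prod_measure m1 m2) h A).
apply/esym/(@product_measure_unique _ _ _ _ _ m1 m2 (pushforward (prod_measure m1 m2) h)) => //.
move=> X Y mX mY; rewrite /= /pushforward /prod_measure.
have -> : h @^-1` (X `*` Y) = (s1 @^-1` X) `*` (s2 @^-1` Y) by [].
rewrite product_measure1E ?ps1 ?ps2 //.
  by rewrite -[X in measurable X]setTI; exact: ms1.
by rewrite -[X in measurable X]setTI; exact: ms2.
Qed.

End ProductPreserving.

Section Lebesgue.
Context {R : realType}.
Local Notation leb := (@lebesgue_measure R).
Local Notation mR := (measurableTypeR R).

Lemma lebesgue_shift (a : R) : @measure_preserving _ mR R leb (fun x => x + a).
Proof.
have ms : measurable_fun [set: mR] (fun x : mR => x + a : mR).
  by apply: measurable_funD => //; exact: measurable_cst.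
split=> // A mA.
rewrite -[LHS]/(pushforward leb (fun x : mR => x + a : mR) A).
apply/esym/lebesgue_measure_unique => //= _ [[x y]] _ <-.
have -> : pushforward leb (fun x : mR => x + a : mR) `]x, y] = leb `]x - a, y - a]%classic.
  rewrite /pushforward; congr (lebesgue_measure _); apply/seteqP; split=> t /=;
  by rewrite !in_itv /= ltrBlDr lerBrDr.
rewrite /= !lebesgue_measure_itv /= !lte_fin ltrD2r.
by case: ifP => // _; rewrite -!EFinB; congr (_%:E); ring.
Qed.

End Lebesgue.

Section Lebesgue3.
Context {R : realType}.
Local Notation leb := (@lebesgue_measure R).
Local Notation mR := (measurableTypeR R).
Local Notation R3 := (mR * (mR * mR))%type.
Implicit Types (v : 'rV[R]_3) (t : R3) (L : 'M[R]_3).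

(** The translation by [v], in the coordinates of [vec3]. *)
Definition shift3 v t : R3 :=
  (t.1 + v 0 (inord 0), (t.2.1 + v 0 (inord 1), t.2.2 + v 0 (inord 2))).

Lemma vec3_shift v t : vec3 (shift3 v t) = vec3 t + v.
Proof.
apply/rowP => j; rewrite !mxE; case: j => -[|[|[|//]]] hj /=;
  congr (_ + v 0 _); apply: val_inj; by rewrite /= inordK.
Qed.

Lemma shift3_preserving v : measure_preserving (@leb3 R) (shift3 v).
Proof.
apply: (@prod_measure_preserving _ _ _ _ _ leb (prod_measure leb leb)
  (fun x : mR => x + v 0 (inord 0))
  (fun y : mR * mR => (y.1 + v 0 (inord 1), y.2 + v 0 (inord 2)))).
  exact: lebesgue_shift.
apply: (@prod_measure_preserving _ _ _ _ _ leb leb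
  (fun x : mR => x + v 0 (inord 1)) (fun x : mR => x + v 0 (inord 2)));
  exact: lebesgue_shift.
Qed.

Lemma measurable_vec3 (j : 'I_3) :
  measurable_fun setT (fun t => vec3 t 0 j : mR).
Proof.
case: j => -[|[|[|//]]] hj.
- have -> : (fun t => vec3 t 0 (Ordinal hj)) = fun t => t.1.
    by apply/funext => t; rewrite mxE.
  exact: measurable_fst.
- have -> : (fun t => vec3 t 0 (Ordinal hj)) = fun t => t.2.1.
    by apply/funext => t; rewrite mxE.
  exact: (measurableT_comp measurable_fst measurable_snd).
have -> : (fun t => vec3 t 0 (Ordinal hj)) = fun t => t.2.2.
  by apply/funext => t; rewrite mxE.
exact: (measurableT_comp measurable_snd measurable_snd).
Qed.

Lemma measurable_bigsum d (T : measurableType d) (J : Type) (s : seq J)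
    (f : J -> T -> mR) :
  (forall j, measurable_fun setT (f j)) ->
  measurable_fun setT (fun x => \sum_(j <- s) f j x : mR).
Proof.
move=> mf; elim: s => [|j s IHs].
  have -> : (fun x => \sum_(j <- [::]) f j x) = cst (0 : mR).
    by apply/funext => x; rewrite big_nil.
  exact: measurable_cst.
have -> : (fun x => \sum_(i <- j :: s) f i x) =
    f j \+ (fun x => \sum_(i <- s) f i x).
  by apply/funext => x; rewrite big_cons.
exact: (measurable_funD (mf j) IHs).
Qed.

Lemma measurable_open_ball (a : 'rV[R]_3) rho :
  measurable [set t : R3 | open_ball a rho (vec3 t)].
Proof.
pose g (t : R3) : mR := \sum_(j < 3) (vec3 t 0 j - a 0 j) ^+ 2.
have mf : measurable_fun setT g.
  apply: measurable_bigsum => j; apply: measurable_funX; apply: measurable_funB.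
    exact: measurable_vec3.
  exact: measurable_cst.
have -> : [set t : R3 | open_ball a rho (vec3 t)] =
    setT `&` g @^-1` `]-oo, rho ^+ 2[%classic.
  by rewrite setTI; apply/seteqP; split=> t /=; rewrite in_itv.
by apply: mf => //; exact: measurable_itv.
Qed.

(** The fundamental cell of the lattice with basis the rows of [L]. *)
Definition cell3 L : set R3 := [set t | cell L (vec3 t)].

Lemma cell_coord L y : L \in unitmx ->
  cell L y <-> forall j, 0 <= (y *m invmx L) 0 j < 1.
Proof.
move=> uL; split=> [[t ht ->] j|h]; first by rewrite mulmxK.
by exists (y *m invmx L) => //; rewrite mulmxKV.
Qed.

Lemma measurable_cell3 L : L \in unitmx -> measurable (cell3 L).
Proof.
move=> uL; pose g (j : 'I_3) (t : R3) : mR := (vec3 t *m invmx L) 0 j.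
have mg j : measurable_fun setT (g j).
  have -> : g j = fun t => \sum_k vec3 t 0 k * invmx L k j.
    by apply/funext => t; rewrite /g mxE.
  apply: measurable_bigsum => k; apply: measurable_funM.
    exact: measurable_vec3.
  exact: measurable_cst.
have -> : cell3 L = \bigcap_(j in [set: 'I_3]) (g j @^-1` `[0, 1[%classic).
  apply/seteqP; split=> t.
    by move=> /(cell_coord _ uL) h j _ /=; rewrite in_itv; exact: h.
  by move=> h; apply/(cell_coord _ uL) => j; have := h j I; rewrite /= in_itv.
apply: fin_bigcap_measurable => // j _; rewrite -[X in measurable X]setTI.
by apply: mg => //; exact: measurable_itv.
Qed.

(** The lattice point with integer coordinates [k] in the rows of [L]. *)
Definition lattice_pt L (k : 'rV[int]_3) : 'rV[R]_3 := map_mx intr k *m L.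

Lemma cell_cover L y : L \in unitmx -> exists k, cell L (y - lattice_pt L k).
Proof.
move=> uL; exists (\row_j Num.floor ((y *m invmx L) 0 j)).
apply/(cell_coord _ uL) => j; rewrite mulmxBl mulmxK // !mxE.
have := floor_itv ((y *m invmx L) 0 j); rewrite mxE rmorphD /= => /andP[h1 h2].
by rewrite subr_ge0 h1 ltrBlDl.
Qed.

Lemma cell_uniq L y k k' : L \in unitmx ->
  cell L (y - lattice_pt L k) -> cell L (y - lattice_pt L k') -> k = k'.
Proof.
move=> uL; have fl k0 : cell L (y - lattice_pt L k0) ->
    forall j, k0 0 j = Num.floor ((y *m invmx L) 0 j).
  move=> /(cell_coord _ uL) h j; have := h j.
  rewrite mulmxBl mulmxK // mxE [X in _ + X]mxE [X in _ - X]mxE.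
  move=> /andP[h1 h2].
  apply/esym/floor_def; rewrite -subr_ge0 h1 /= rmorphD /=.
  by rewrite -ltrBlDl.
by move=> /fl h /fl h'; apply/rowP => j; rewrite h h'.
Qed.

Lemma cell3_measure L1 L2 Lambda : lattice_basis L1 Lambda ->
  lattice_basis L2 Lambda -> leb3 (cell3 L1) = leb3 (cell3 L2).
Proof.
move=> [u1 E1] [u2 E2].
have to2 k : exists k', lattice_pt L1 k = lattice_pt L2 k'.
  have : Lambda (lattice_pt L1 k) by rewrite E1; exists k.
  by rewrite E2 => -[k' ->]; exists k'.
have to1 k : exists k', lattice_pt L2 k = lattice_pt L1 k'.
  have : Lambda (lattice_pt L2 k) by rewrite E2; exists k.
  by rewrite E1 => -[k' ->]; exists k'.
have lattice_ptN L k : lattice_pt L (- k) = - lattice_pt L k.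
  by rewrite /lattice_pt map_mxN mulNmx.
have lattice_pt_inj L k k' : L \in unitmx ->
    lattice_pt L k = lattice_pt L k' -> k = k'.
  move=> uL /(congr1 (fun M => M *m invmx L)); rewrite !mulmxK // => /rowP h.
  by apply/rowP => j; have := h j; rewrite !mxE => /intr_inj.
(* Both families of translations are indexed by the coordinates in [L1]. *)
apply: (@fundamental_domain_measure _ _ _ (@leb3 R) 'rV[int]_3
  (fun k => shift3 (- lattice_pt L1 k)) (fun k => shift3 (lattice_pt L1 k))).
- exact: measurable_cell3.
- exact: measurable_cell3.
- by move=> k; exact: shift3_preserving.
- by move=> k; exact: shift3_preserving.
- move=> k [t1 [t2 t3]]; rewrite /shift3 /=.
  have N j : (- lattice_pt L1 k) 0 j = - lattice_pt L1 k 0 j by rewrite mxE.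
  by rewrite !N !subrK.
- move=> t; have [k h] := cell_cover (vec3 t) u1; exists k.
  by rewrite /cell3 /= vec3_shift.
- by move=> t k k'; rewrite /cell3 /= !vec3_shift; exact: cell_uniq.
- move=> t; have [k h] := cell_cover (vec3 t) u2; have [k' e] := to1 k.
  by exists (- k'); rewrite /cell3 /= vec3_shift lattice_ptN -e.
move=> t k k'; rewrite /cell3 /= !vec3_shift.
have [a ea] := to2 (- k); have [b eb] := to2 (- k').
have {}ea : lattice_pt L1 k = - lattice_pt L2 a by rewrite -ea lattice_ptN opprK.
have {}eb : lattice_pt L1 k' = - lattice_pt L2 b by rewrite -eb lattice_ptN opprK.
rewrite ea eb => ha hb; apply: (lattice_pt_inj L1) => //.
by rewrite ea eb (cell_uniq u2 ha hb).
Qed.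

Lemma leb3_setX (X Y Z : set mR) : measurable X -> measurable Y -> measurable Z ->
  leb3 (X `*` (Y `*` Z)) = (leb X * (leb Y * leb Z))%E.
Proof.
move=> mX mY mZ.
rewrite -[LHS]/((leb \x prod_measure leb leb)%E (X `*` (Y `*` Z))).
rewrite product_measure1E //; last exact: measurableX.
by rewrite -[X in (_ * X)%E = _]/((leb \x leb)%E (Y `*` Z)) product_measure1E.
Qed.

(** Otherwise the whole space, covered by countably many translates of the
    cell, would be null. *)
Lemma cell3_measure_neq0 L : L \in unitmx -> leb3 (cell3 L) != 0%E.
Proof.
move=> uL; apply/eqP => c0.
have T0 : leb3 [set: R3] = 0%E.
  apply: (@fundamental_domain_null _ _ _ (@leb3 R) 'rV[int]_3
    (fun k => shift3 (- lattice_pt L k)) _ _ _ _ _ c0).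
  - exact: measurable_cell3.
  - by move=> k; exact: shift3_preserving.
  - move=> t; have [k h] := cell_cover (vec3 t) uL; exists k.
    by rewrite /cell3 /= vec3_shift.
  - by move=> t k k'; rewrite /cell3 /= !vec3_shift; exact: cell_uniq.
have mI : measurable (`[0, 1]%classic : set mR) by exact: measurable_itv.
have I1 : leb `[0, 1]%classic = 1%E.
  by rewrite lebesgue_measure_itv /= lte_fin ltr01 oppr0 adde0.
pose J : set mR := `[0, 1]%classic.
have : (leb3 (J `*` (J `*` J)) <= leb3 [set: R3])%E.
  apply: le_measure; rewrite ?inE //.
  by apply: measurableX => //; exact: measurableX.
by rewrite T0 leb3_setX // I1 !mule1 lee_fin ler10.
Qed.

Lemma cell3_measure_fin L : L \in unitmx -> leb3 (cell3 L) \is a fin_num.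
Proof.
move=> uL; pose M : R := \sum_i \sum_j `|L i j|.
have mI : measurable (`[- M, M]%classic : set mR) by exact: measurable_itv.
have cM : cell3 L `<=`
    (`[- M, M]%classic `*` (`[- M, M]%classic `*` `[- M, M]%classic)).
  move=> t [s hs ts].
  have b j : `|vec3 t 0 j| <= M.
    rewrite ts mxE (le_trans (ler_norm_sum _ _ _)) // /M.
    apply: ler_sum => i _; rewrite normrM.
    have /andP[s0 s1] := hs i; rewrite ger0_norm //.
    apply: (@le_trans _ _ `|L i j|); first by rewrite ler_piMl // ltW.
    by rewrite (bigD1 j) //= lerDl sumr_ge0.
  have := b (inord 0); have := b (inord 1); have := b (inord 2).
  rewrite !mxE !inordK //= !ler_norml => h2 h1 h0.
  by rewrite /= !in_itv.
rewrite ge0_fin_numE ?measure_ge0 //.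
apply: le_lt_trans (_ : leb3 _ < +oo)%E.
  apply: le_measure cM; rewrite inE; first exact: measurable_cell3.
  by apply: measurableX => //; exact: measurableX.
rewrite leb3_setX // lebesgue_measure_itv /=.
by case: ifP => _; rewrite ?mul0e ?ltry // -!EFinB -!EFinM ltry.
Qed.

End Lebesgue3.

(** * Integration *)

Section ProductIntegral.
Local Open Scope ereal_scope.
Context d1 d2 (T1 : measurableType d1) (T2 : measurableType d2) (R : realType).
Variable m1 : {sigma_finite_measure set T1 -> \bar R}.
Variable m2 : {sigma_finite_measure set T2 -> \bar R}.

Lemma integral_setX_fst (D1 : set T1) (D2 : set T2) (h : T1 -> R) :
    measurable D1 -> measurable D2 -> m2 D2 \is a fin_num ->
    m1.-integrable D1 (fun x => (h x)%:E) ->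
    (prod_measure m1 m2).-integrable (D1 `*` D2) (fun p => (h p.1)%:E) ->
  \int[prod_measure m1 m2]_(p in D1 `*` D2) (h p.1)%:E =
  m2 D2 * \int[m1]_(x in D1) (h x)%:E.
Proof.
move=> mD1 mD2 fD2 ih ihW.
have mD : measurable (D1 `*` D2) by exact: measurableX.
rewrite integral_mkcond.
move/(integrable_mkcond _ mD) : ihW; set f := _ \_ _ => if_.
rewrite -[LHS]/(\int[m1 \x m2]_p f p) -(integral12_prod_meas1 if_).
rewrite -(fineK fD2) muleC -integralZr // [RHS]integral_mkcond.
apply: eq_integral => x _; rewrite /fubini_F patchE.
case: ifPn => xD1.
  rewrite (fineK fD2) -(integral_cst m2 mD2 (h x)%:E) [RHS]integral_mkcond.
  apply: eq_integral => y _; rewrite /f !patchE.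
  by rewrite in_setX xD1.
by rewrite integral0_eq // => y _; rewrite /f patchE in_setX (negbTE xD1).
Qed.

End ProductIntegral.

Lemma Rintegral_setX_fst d1 d2 (T1 : measurableType d1) (T2 : measurableType d2)
    (R : realType) (m1 : {sigma_finite_measure set T1 -> \bar R})
    (m2 : {sigma_finite_measure set T2 -> \bar R})
    (D1 : set T1) (D2 : set T2) (h : T1 -> R) :
    measurable D1 -> measurable D2 -> m2 D2 \is a fin_num ->
    m1.-integrable D1 (fun x => (h x)%:E) ->
    (prod_measure m1 m2).-integrable (D1 `*` D2) (fun p => (h p.1)%:E) ->
  Rintegral (prod_measure m1 m2) (D1 `*` D2) (fun p => h p.1) =
  fine (m2 D2) * Rintegral m1 D1 h.
Proof.
move=> mD1 mD2 fD2 ih ihW; rewrite /Rintegral integral_setX_fst // fineM //.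
exact: integrable_fin_num.
Qed.

Theorem mainTheorem2 (R : realType) (Lambda : set 'rV[R]_3)
    (hLambda : is_lattice Lambda) :
  exists2 c : R[i], c != 0 &
    forall (Lt : 'M[R]_3) (hLt : lattice_basis Lt (dual_lattice Lambda))
      (a : 'rV[R]_3) (rho : R) (hrho : 0 < rho)
      (phi f : 'rV[R]_3 -> R)
      (hphi : monge_ampere_potential (open_ball a rho) phi)
      (hf : smooth_on (open_ball a rho) f)
      (hSL : special_lagrangian (open_ball a rho) phi (graphC phi f))
      (r : nat) (hr : (1 <= r)%N)
      (e : 'I_3 -> 'rV[R]_3 -> 'M[R[i]]_r)
      (he_smooth : forall k, smooth_mx_on (open_ball a rho) (e k))
      (he_herm : forall k x, open_ball a rho x -> e k x \is hermsymmx)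
      (hintC : formC_integrable (open_ball a rho) (CS_form (connC e)))
      (hintW : formW_integrable (open_ball a rho) Lt
                 (CShol_form phi (connW phi f e) (connW0 phi f))),
    formW_integral (open_ball a rho) Lt
      (CShol_form phi (connW phi f e) (connW0 phi f)) =
    c * formC_integral (open_ball a rho) (CS_form (connC e)).
Proof.
pose vol (L : 'M[R]_3) : R := fine (leb3 (cell3 L)).
have vol0 L : L \in unitmx -> vol L != 0.
  by move=> uL; rewrite fine_eq0 ?cell3_measure_fin // cell3_measure_neq0.
(* Any basis of the dual lattice may define the constant. *)
have [[L0 hL0]|noL] :=
  pselect (exists L, lattice_basis L (dual_lattice Lambda)); last first.
  by exists 1; [exact: oner_neq0 | move=> L hL; case: noL; exists L].
exists ('i * (vol L0)%:C).
  have [u0 _] := hL0; rewrite mulf_neq0 //.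
    by apply/eqP => /(congr1 (@complex.Im R)) /= /eqP; rewrite oner_eq0.
  by rewrite (inj_eq (@complexI R)) vol0.
move=> Lt hLt a rho _ phi f [phi_smooth phi_pos _] _ _ r _ e e_smooth _ hC hW.
rewrite /vol (cell3_measure hL0 hLt) -/(vol Lt).
have [uLt _] := hLt.
set B := open_ball a rho in phi_smooth phi_pos e_smooth hC hW *.
pose cs (t : measurableTypeR R * (measurableTypeR R * measurableTypeR R))
    : R[i] := top_coef (CS_form (connC e)) (vec3 t).
pose hol := CShol_form phi (connW phi f e) (connW0 phi f).
(* The integrand on [W] does not depend on the torus coordinates. *)
have holE p : p \in domW B Lt ->
    top_coef hol (row_mx (vec3 p.1) (vec3 p.2)) = 'i * cs p.1.
  rewrite inE => -[Bp _].
  rewrite (@CShol_top R r B) ?row_mxKl //; first exact: open_ball_near.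
  exact: open_ball_near_lsubmx.
have Re_i (z : R[i]) : complex.Re ('i * z) = - complex.Im z.
  by case: z => x y; simpc.
have Im_i (z : R[i]) : complex.Im ('i * z) = complex.Re z.
  by case: z => x y; simpc.
have mB := measurable_open_ball a rho.
have mcell := measurable_cell3 uLt.
have fcell := cell3_measure_fin uLt.
have [iCr iCi] := hC; have [iWr iWi] := hW.
have E1 : Rintegral leb6 (domW B Lt)
    (fun p => complex.Re (top_coef hol (row_mx (vec3 p.1) (vec3 p.2)))) =
    vol Lt * - Rintegral leb3 [set t | B (vec3 t)] (fun t => complex.Im (cs t)).
  have iN : leb3.-integrable [set t | B (vec3 t)]
      (fun t => (- complex.Im (cs t))%:E).
    exact: integrableN iCi.
  rewrite (@eq_Rintegral _ _ _ _ _ (fun p => - complex.Im (cs p.1))) =>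
    [|p pD]; last first.
    by rewrite holE // Re_i.
  rewrite (Rintegral_setX_fst mB mcell fcell iN); last first.
    apply: (eq_integrable (measurableX mB mcell) _ _ _ iWr).
    by move=> p pD; rewrite -/hol holE // Re_i.
  congr (_ * _); rewrite -[RHS]mulN1r -RintegralZl //.
  by apply: eq_Rintegral => t _; rewrite mulN1r.
have E2 : Rintegral leb6 (domW B Lt)
    (fun p => complex.Im (top_coef hol (row_mx (vec3 p.1) (vec3 p.2)))) =
    vol Lt * Rintegral leb3 [set t | B (vec3 t)] (fun t => complex.Re (cs t)).
  rewrite (@eq_Rintegral _ _ _ _ _ (fun p => complex.Re (cs p.1))) =>
    [|p pD]; last first.
    by rewrite holE // Im_i.
  rewrite (Rintegral_setX_fst mB mcell fcell iCr) //.
  apply: (eq_integrable (measurableX mB mcell) _ _ _ iWi).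
  by move=> p pD; rewrite -/hol holE // Im_i.
rewrite /formW_integral /formC_integral /cintegral -/hol E1 E2.
rewrite -/cs; simpc; congr (_ +i* _); ring.
Qed.
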